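(* For $n\ge 2$, $$\chi(\Pi_{D_n}^{(2)},t)=\chi(\Pi_{B_n}^{(2)},t)+\binom{n}{2}\,t\,\chi(\Pi_{B_{n-2}}^{(2)},t).$$
   Context: $W(B_n)=\{\pm1\}^n\rtimes S_n$ is the Coxeter group of signed permutations acting on $\mathbb{R}^n$; $W(D_n)$ is the subgroup of signed permutations with an even number of sign changes. Conventions: $B_0$ is the empty arrangement (trivial group), $B_1=A_1$, $D_2=A_1\times A_1$ (reducible), $D_3=A_3$. For a finite Coxeter group $W$ (of type $X_n$), $\Pi_W^{(2)}=\Pi_{X_n}^{(2)}$ is the poset, under inclusion, of parabolic subgroups of $W$ (pointwise stabilizers of subspaces of the reflection representation) all of whose irreducible components have even rank; its minimum $\hat 0$ is the trivial subgroup. Its characteristic polynomial is $\chi(\Pi_W^{(2)},t)=\sum_{W'\in\Pi_W^{(2)}}\mu(\hat 0,W')\,t^{\mathrm{rk}(W')/2}$, where $\mu$ is the Möbius function of $\Pi_W^{(2)}$ and $\mathrm{rk}(W')$ is the rank of $W'$ as a Coxeter group. *)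

(* Defs.v *)
From HB Require Import structures.
From mathcomp Require Import all_boot all_order all_algebra all_fingroup.
From mathcomp Require Import all_solvable mxrepresentation.
From mathcomp Require Import boolp reals.

Set Implicit Arguments.
Unset Strict Implicit.
Unset Printing Implicit Defensive.

Import GRing.Theory GroupScope.
Local Open Scope ring_scope.

(* Moebius function of a finite subset P of T ordered by le.  The first       *)
(* argument is a recursion bound: each recursive call strictly decreases y,   *)
(* so any bound exceeding the number of elements of P below y gives the same  *)
(* value, see moebiusE.                                                       *)
Section Moebius.

Variables (T : finType) (le : rel T) (P : {set T}).

Fixpoint moebius_rec (k : nat) (x y : T) : int :=
  if x == y then 1
  else if k is k'.+1 then
    if le x y then
      - \sum_(z in P | [&& le x z, le z y & z != y]) moebius_rec k' x z
    else 0
  else 0.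

Definition moebius (x y : T) : int := moebius_rec #|P| x y.

Hypothesis le_refl : reflexive le.
Hypothesis le_anti : antisymmetric le.
Hypothesis le_trans : transitive le.

Let below y := [set z in P | le z y & z != y].

Lemma below_proper y z : z \in P -> le z y -> z != y -> (#|below z| < #|below y|)%N.
Proof.
move=> zP zy zNy; apply/proper_card/properP; split.
  apply/subsetP=> u; rewrite !inE => /and3P[uP uz uNz].
  rewrite uP (le_trans uz zy) /=; apply: contra_neq uNz => uy.
  by apply: le_anti; rewrite uz uy zy.
by exists z; rewrite !inE ?eqxx ?zP ?zy ?zNy ?andbF.
Qed.

Lemma moebius_rec_stable k l x y :
    (#|below y| < k)%N -> (#|below y| < l)%N ->
  moebius_rec k x y = moebius_rec l x y.
Proof.
elim: k l y => [|k IHk] [|l] y //= yk yl.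
case: eqP => // _; case: ifP => // _; congr (- _).
apply: eq_bigr => z /and4P[zP _ zy zNy].
by apply: IHk; apply: leq_trans (below_proper zP zy zNy) _.
Qed.

Lemma moebiusE x y : x \in P -> y \in P ->
  moebius x y =
    if x == y then 1
    else if le x y then
      - \sum_(z in P | [&& le x z, le z y & z != y]) moebius x z
    else 0.
Proof.
move=> xP yP; have ltP z : z \in P -> (#|below z| < #|P|)%N.
  move=> zP; apply/proper_card/properP; split.
    by apply/subsetP=> u; rewrite inE => /and3P[].
  by exists z => //; rewrite !inE eqxx !andbF.
rewrite {1}/moebius; have := ltP y yP.
case EP: #|P| => [|k] //= yk.
case: eqP => // _; case: ifP => // _; congr (- _).
apply: eq_bigr => z /and4P[zP _ zy zNy]; rewrite /moebius EP.
have lez := leq_trans (below_proper zP zy zNy) yk.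
by apply: moebius_rec_stable => //; apply: leq_trans lez _.
Qed.

End Moebius.

Section ReflectionGroup.

(* G acts on row vectors 'rV[R]_n, on the right, through rG. *)
Variables (R : realType) (gT : finGroupType) (G : {group gT}) (n : nat).
Variable rG : mx_representation R G n.

Definition is_reflection (w : gT) : bool :=
  (#[w] == 2)%N && (\rank (rG w - 1%:M)%R == 1)%N.

Definition reflection_subgroup (H : {group gT}) : bool :=
  (H \subset G) && (<<[set w in H | is_reflection w]>>%g == H :> {set gT}).

(* Irreducibility as a reflection group: the factors have to be generated by  *)
(* reflections.  Indecomposability of the abstract group would be different:  *)
(* the irreducible Coxeter group G_2 is abstractly A_1 x A_2.                 *)
Definition irreducible_reflection_subgroup (H : {group gT}) : bool :=
  [&& reflection_subgroup H, H :!=: 1%g &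
    ~~ [exists K : {group gT}, exists L : {group gT},
          [&& reflection_subgroup K, reflection_subgroup L,
              K :!=: 1%g, L :!=: 1%g & (K \x L)%g == H :> {set gT}]]].

Definition irreducible_components (H : {group gT}) : {set {group gT}} :=
  [set K : {group gT} | irreducible_reflection_subgroup K &
     [exists L : {group gT},
        reflection_subgroup L && ((K \x L)%g == H :> {set gT})]].

(* The rank of a finite reflection group is the dimension of its essential    *)
(* part, i.e., the codimension of its fixed space.                            *)
Definition reflection_rank (H : {group gT}) : nat :=
  (n - \rank (rfix_mx rG H))%N.

(* A subspace is given as the row space of a square matrix U; rstab rG U is   *)
(* its pointwise stabilizer in G.                                             *)
Definition parabolic (H : {group gT}) : Prop :=
  exists U : 'M[R]_n, H :=: rstab rG U.

Definition even_parabolics : {set {group gT}} :=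
  [set H : {group gT} | `[< parabolic H >] &
     [forall K in irreducible_components H, ~~ odd (reflection_rank K)]].

Definition moebius_even : {group gT} -> {group gT} -> int :=
  moebius (fun H K : {group gT} => H \subset K) even_parabolics.

Definition even_char_poly : {poly int} :=
  \sum_(H in even_parabolics)
     moebius_even 1%G H *: 'X^((reflection_rank H)./2).

End ReflectionGroup.

(* The signed permutation (e, s) sends the i-th basis vector to               *)
(* (-1)^(e i) times the (s i)-th one; products are composed left to right, as *)
(* for 'S_n.                                                                  *)
Record signed_perm (n : nat) :=
  SignedPerm { sp_sign : {ffun 'I_n -> bool}; sp_perm : 'S_n }.

Section SignedPermGroup.

Variable n : nat.
Implicit Types u v w : signed_perm n.

Definition sp_pair w := (sp_sign w, sp_perm w).
Definition pair_sp (p : {ffun 'I_n -> bool} * 'S_n) := SignedPerm p.1 p.2.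
Lemma sp_pairK : cancel sp_pair pair_sp. Proof. by case. Qed.

HB.instance Definition _ := Equality.copy (signed_perm n) (can_type sp_pairK).
HB.instance Definition _ := Choice.copy (signed_perm n) (can_type sp_pairK).
HB.instance Definition _ := Countable.copy (signed_perm n) (can_type sp_pairK).
HB.instance Definition _ := Finite.copy (signed_perm n) (can_type sp_pairK).

Definition sp_mul u v : signed_perm n :=
  SignedPerm [ffun i => sp_sign u i (+) sp_sign v (sp_perm u i)]
             (sp_perm u * sp_perm v)%g.

Definition sp_one : signed_perm n := SignedPerm [ffun=> false] 1%g.

Definition sp_inv u : signed_perm n :=
  SignedPerm [ffun i => sp_sign u ((sp_perm u)^-1%g i)] (sp_perm u)^-1%g.

Lemma sp_mulA : associative sp_mul.
Proof.
move=> u v w; congr SignedPerm; last exact: mulgA.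
by apply/ffunP=> i; rewrite !ffunE permM addbA.
Qed.

Lemma sp_mul1 : left_id sp_one sp_mul.
Proof.
case=> e s; congr SignedPerm; last exact: mul1g.
by apply/ffunP=> i; rewrite !ffunE perm1.
Qed.

Lemma sp_mulV : left_inverse sp_one sp_inv sp_mul.
Proof.
case=> e s; congr SignedPerm; last exact: mulVg.
by apply/ffunP=> i; rewrite !ffunE /= addbb.
Qed.

HB.instance Definition _ :=
  Finite_isGroup.Build (signed_perm n) sp_mulA sp_mul1 sp_mulV.

Definition WB : {group signed_perm n} := [set: signed_perm n]%G.

Definition sp_odd w : bool := odd #|[set i | sp_sign w i]|.

Lemma sp_oddE w : sp_odd w = \big[addb/false]_i sp_sign w i.
Proof.
rewrite /sp_odd -sum1_card (big_morph odd oddD (erefl _)) big_mkcond /=.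
by apply: eq_bigr => i _; rewrite inE; case: (sp_sign w i).
Qed.

Lemma sp_oddM u v : sp_odd (u * v)%g = sp_odd u (+) sp_odd v.
Proof.
rewrite !sp_oddE.
under eq_bigr do rewrite ffunE.
rewrite big_split /=; congr addb.
by rewrite [RHS](reindex_inj (@perm_inj _ (sp_perm u))) /=.
Qed.

Lemma WD_group_set : group_set [set w | ~~ sp_odd w].
Proof.
apply/group_setP; split=> [|u v]; last first.
  by rewrite !inE sp_oddM => /negbTE-> /negbTE->.
by rewrite inE sp_oddE big1 // => i _; rewrite ffunE.
Qed.

Definition WD : {group signed_perm n} := Group WD_group_set.

Variable R : realType.

Definition sp_mx w : 'M[R]_n :=
  \matrix_(i, j) ((-1) ^+ sp_sign w i *+ (sp_perm w i == j)).

Lemma sp_mx_repr : mx_repr WB sp_mx.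
Proof.
split=> [|u v _ _].
  by apply/matrixP=> i j; rewrite !mxE ffunE perm1 expr0.
apply/matrixP=> i j; rewrite !mxE (bigD1 (sp_perm u i)) //= big1 => [|k /negbTE].
  by rewrite !mxE eqxx mulr1n addr0 ffunE permM signr_addb mulrnAr.
by rewrite !mxE eq_sym => ->; rewrite mulr0n mul0r.
Qed.

Definition reprB : mx_representation R WB n := MxRepresentation sp_mx_repr.

Definition reprD : mx_representation R WD n := subg_repr reprB (subsetT WD).

End SignedPermGroup.

Arguments reprB n R : clear implicits.
Arguments reprD n R : clear implicits.

(* Main.v *)
(* The pointwise stabilizers in W(B_n) are the groups of signed permutations   *)
(* preserving a labelling c of the coordinates up to the signs they carry: the *)
(* coordinates with label 0 form the zero block Z, and the others are grouped  *)
(* by absolute value.  Such a stabilizer is a product of B_Z (or D_Z) and of   *)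
(* symmetric groups on the nonzero blocks, so it is even iff #|Z| is even and  *)
(* all nonzero blocks have odd size, with the extra condition #|Z| <> 2 in     *)
(* type D because D_2 is reducible.  Hence Pi_D is Pi_B with the elements      *)
(* having #|Z| = 2 removed.  For a pair S let z_S be the stabilizer with zero  *)
(* block S and singletons elsewhere.  The function                             *)
(*   f H = mu_B(1, H) + \sum_(#|S| = 2) [z_S <= H] mu_B(z_S, H)                *)
(* vanishes on the removed elements, so it is the Moebius function of Pi_D;    *)
(* and the interval above z_S is Pi_B_(n-2), with ranks shifted by 2.          *)

From HB Require Import structures.
Require Import Defs.
From mathcomp Require Import all_boot all_order all_algebra all_fingroup.
From mathcomp Require Import cyclic mxrepresentation boolp reals zify lra.

Set Implicit Arguments.
Unset Strict Implicit.
Unset Printing Implicit Defensive.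

Import Order.TTheory GRing.Theory Num.Theory.
Local Open Scope ring_scope.

(** * Labellings of the coordinates *)

(** Every parabolic subgroup is the stabilizer [gstab] of an integer labelling ([parabolic_label]),
    and in type B containments are read off the relations [lrel]. Direct factors of a stabilizer are
    stabilizers attached to unions of blocks ([factor_gstab]); with the rank formula [rank_gstab]
    this turns evenness into the parity conditions of [even_gstabP]. Intersecting with W(D_n) then
    identifies the type D poset with the type B poset minus the elements whose zero block has size 2
    ([even_D_image], [even_part_sub]), with unchanged ranks.

    The Moebius function of a poset with a minimum is determined by its sums over lower sets. Adding
    to mu_B(1, H) the values mu_B(z_S, H) for all pairs S gives [correction], which vanishes on the
    removed elements ([correction_eq0]). Deleting them therefore keeps all these sums, and
    [correction] is the type D Moebius function ([moebius_evenD]). Summed against powers of t it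
    yields the type B polynomial plus one term per pair S. Deleting the coordinates of S turns the
    elements above z_S into the poset of B_(n-2), with ranks lowered by 2, so each such term is t
    times the polynomial of B_(n-2) ([shifted_char_poly]). *)

Section Labels.

Variable n : nat.
Implicit Types (i j k : 'I_n) (a b : bool) (u v w : signed_perm n).

(* For i = j and a set this says c i = 0. *)
Definition lrel (V : zmodType) (c : 'I_n -> V) i j a : bool :=
  c j == if a then - c i else c i.

Section Generic.
Variables (V : zmodType) (c : 'I_n -> V).

Lemma lrel_refl i : lrel c i i false.
Proof. exact: eqxx. Qed.

Lemma lrel_sym i j a : lrel c i j a = lrel c j i a.
Proof. by rewrite /lrel; case: a; rewrite eq_sym // eqr_oppLR. Qed.

Lemma lrel_trans i j k a b :
  lrel c i j a -> lrel c j k b -> lrel c i k (a (+) b).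
Proof.
by rewrite /lrel; case: a; case: b => /eqP + /eqP => -> -> /=; rewrite ?opprK.
Qed.

Lemma stab_group_set :
  group_set [set w | [forall i, lrel c i (sp_perm w i) (sp_sign w i)]].
Proof.
apply/group_setP; split=> [|u v].
  by rewrite inE; apply/forallP=> i; rewrite ffunE perm1 lrel_refl.
rewrite !inE => /forallP uH /forallP vH; apply/forallP=> i.
by rewrite ffunE permM; apply: lrel_trans (uH i) (vH _).
Qed.

(** Labels live in an arbitrary abelian group because a subspace given by a matrix labels each
    coordinate by a column; see [sp_mx_fix]. *)
Definition stab : {group signed_perm n} := Group stab_group_set.

Lemma stabP w :
  reflect (forall i, lrel c i (sp_perm w i) (sp_sign w i)) (w \in stab).
Proof. by rewrite inE; apply: forallP. Qed.

End Generic.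

Lemma stab_sub (V V' : zmodType) (c : 'I_n -> V) (c' : 'I_n -> V') :
    (forall i j a, lrel c i j a -> lrel c' i j a) -> stab c \subset stab c'.
Proof.
by move=> cc'; apply/subsetP=> w /stabP wc; apply/stabP => i; apply: cc'.
Qed.

Lemma stab_eq (V V' : zmodType) (c : 'I_n -> V) (c' : 'I_n -> V') :
  (forall i j a, lrel c i j a = lrel c' i j a) -> stab c = stab c'.
Proof.
by move=> cc'; apply/val_inj/eqP; rewrite /= eqEsubset !stab_sub // => i j a;
  rewrite cc'.
Qed.

Section Normalize.
Variables (V : zmodType) (c : 'I_n -> V).
Hypothesis V2 : forall x : V, x = - x -> x = 0.

Let nbr i : pred 'I_n := fun j => lrel c i j false || lrel c i j true.
Let root i := odflt i [pick j | nbr i j].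
Let sg i : bool := ~~ lrel c i (root i) false.

(** A nonzero block is named by the index of a chosen representative, shifted by one to be nonzero;
    the sign records how [i] relates to that representative. Only the relations [lrel] are kept,
    which is all that a stabilizer depends on. *)
Definition int_label i : int :=
  if c i == 0 then 0 else (-1) ^+ sg i * (root i).+1%:Z.

Lemma lrel_signs i j a b : c i != 0 -> lrel c i j a -> lrel c i j b -> a = b.
Proof.
move=> ci0; rewrite /lrel => /eqP->.
case: a; case: b => // /eqP E; move: ci0; rewrite (V2 (x := c i)) ?eqxx //.
Qed.

Let rootP i : lrel c i (root i) (sg i).
Proof.
rewrite /sg /root; case: pickP => [j|/(_ i)] /=; last by rewrite /nbr lrel_refl.
by rewrite /nbr; case E: (lrel c i j false) => //=; rewrite E.
Qed.

Let root_eq i j a : lrel c i j a -> root i = root j.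
Proof.
move=> ij; rewrite /root (@eq_pick _ (nbr i) (nbr j)).
  by case: pickP => //= /(_ j); rewrite /nbr lrel_refl.
move=> k; rewrite /nbr; have ji : lrel c j i a by rewrite lrel_sym.
apply/orP/orP => [] [] h.
- by have:= lrel_trans ji h; case: (a) => /= ->; [right|left].
- by have:= lrel_trans ji h; case: (a) => /= ->; [left|right].
- by have:= lrel_trans ij h; case: (a) => /= ->; [right|left].
- by have:= lrel_trans ij h; case: (a) => /= ->; [left|right].
Qed.

Lemma int_labelE i j a : lrel int_label i j a = lrel c i j a.
Proof.
have zE k l b : lrel c k l b -> (c k == 0) = (c l == 0).
  by rewrite /lrel => /eqP->; case: b; rewrite ?oppr_eq0.
have [ci0|ci0] := eqVneq (c i) 0.
  rewrite /lrel /int_label ci0 eqxx.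
  by case: a; rewrite ?oppr0; case: (eqVneq (c j) 0) => // _; rewrite mulf_eq0 signr_eq0.
have [cj0|cj0] := eqVneq (c j) 0.
  rewrite [RHS]/lrel cj0 eq_sym; transitivity false; last first.
    by apply/esym; case: a; rewrite ?oppr_eq0 (negbTE ci0).
  rewrite /lrel /int_label cj0 eqxx (negbTE ci0) eq_sym; apply/negbTE.
  by case: a; rewrite ?oppr_eq0 mulf_eq0 signr_eq0.
have [rij|rij] := eqVneq (root i) (root j); last first.
  transitivity false; last by apply/esym/negP => /root_eq/eqP; apply/negP.
  apply/negP; rewrite /lrel /int_label (negbTE ci0) (negbTE cj0) => h.
  case/eqP: rij; apply/val_inj => /=; move: h.
  by case: a; case: (sg i); case: (sg j) => /eqP /=; lia.
have cij : lrel c i j (sg i (+) sg j).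
  by apply: lrel_trans (rootP i) _; rewrite lrel_sym rij.
have -> : lrel c i j a = (a == sg i (+) sg j).
  by apply/idP/eqP => [h|-> //]; apply: lrel_signs h cij.
rewrite /lrel /int_label (negbTE ci0) (negbTE cj0) rij.
by case: a; case: (sg i); case: (sg j); rewrite /= ?expr0 ?expr1; lia.
Qed.

End Normalize.

Lemma lrel_int0 (c : 'I_n -> int) i : lrel c i i true = (c i == 0).
Proof. by rewrite /lrel; lia. Qed.

(* Off X the labels are made distinct, nonzero and larger in absolute value    *)
(* than those of c: every coordinate outside X becomes a singleton block.      *)
Definition lres (c : 'I_n -> int) (X : {set 'I_n}) i : int :=
  if i \in X then c i else (\sum_j `|c j|)%N%:Z + i.+1%:Z.

Lemma lresE c X i j a :
  lrel (lres c X) i j a =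
    if (i \in X) && (j \in X) then lrel c i j a else (i == j) && ~~ a.
Proof.
have bnd k : (`|c k| <= \sum_j `|c j|)%N by rewrite (bigD1 k) //= leq_addr.
have Ei := bnd i; have Ej := bnd j.
rewrite /lrel /lres; have [<-|] := eqVneq i j.
  by case: (i \in X); case: a => /=; lia.
rewrite -(inj_eq val_inj) /=; move: (\sum_j _)%N (c i) (c j) Ei Ej => M x y Ei Ej.
by case: (i \in X); case: (j \in X) => //=; case: a => /=; lia.
Qed.

(* The reflection exchanging e_i with (-1)^a e_j; for i = j it is the sign     *)
(* change of e_i if a is set, and the identity otherwise.                      *)
Definition tr i j a : signed_perm n :=
  SignedPerm [ffun k => a && ((k == i) || (k == j))] (tperm i j).

End Labels.

(** * Reflections *)

Section SignedTranspositions.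

Variable n : nat.
Implicit Types (i j k : 'I_n) (a b : bool) (u v w : signed_perm n).

Lemma sp_ext u v :
    (forall i, sp_perm u i = sp_perm v i) ->
    (forall i, sp_sign u i = sp_sign v i) -> u = v.
Proof. by case: u v => e s [e' s'] /= /permP-> /ffunP->. Qed.

Lemma sp_permM u v i : sp_perm (u * v)%g i = sp_perm v (sp_perm u i).
Proof. by rewrite permM. Qed.

Lemma sp_signM u v i :
  sp_sign (u * v)%g i = sp_sign u i (+) sp_sign v (sp_perm u i).
Proof. by rewrite ffunE. Qed.

Lemma sp_perm1 i : sp_perm (1%g : signed_perm n) i = i.
Proof. by rewrite perm1. Qed.

Lemma sp_sign1 i : sp_sign (1%g : signed_perm n) i = false.
Proof. by rewrite ffunE. Qed.

Lemma tr_sign i j a k : sp_sign (tr i j a) k = a && ((k == i) || (k == j)).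
Proof. by rewrite ffunE. Qed.

Lemma tr_sym i j a : tr i j a = tr j i a.
Proof.
by apply: sp_ext => k; [rewrite /= tpermC|rewrite !tr_sign orbC].
Qed.

Lemma tr_id i j a : sp_perm (tr i j a) i = j.
Proof. exact: tpermL. Qed.

(** A signed permutation [w] sends the root e_i - (-1)^a e_j of [tr i j a] to a multiple of the root
    of the reflection on the right; [trJ] is the same fact as a conjugation. *)
Lemma trM i j a w : (tr i j a * w = w *
  tr (sp_perm w i) (sp_perm w j) (a (+) sp_sign w i (+) sp_sign w j))%g.
Proof.
apply: sp_ext => k; rewrite ?sp_permM ?sp_signM ?tr_sign /= ?(inj_eq perm_inj).
  by case: tpermP => [->|->|/eqP ki /eqP kj]; rewrite ?tpermL ?tpermR // tpermD // (inj_eq perm_inj) eq_sym.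
case: tpermP => [->|->|/eqP/negbTE-> /eqP/negbTE->]; rewrite ?eqxx ?orbT ?andbT ?andbF ?addbF //;
  by case: (a); case: (sp_sign w i); case: (sp_sign w j).
Qed.

Lemma trJ i j a w : (tr i j a ^ w =
  tr (sp_perm w i) (sp_perm w j) (a (+) sp_sign w i (+) sp_sign w j))%g.
Proof. by rewrite /conjg trM mulgA mulVg mul1g. Qed.

Lemma tr_involutive i j a : (tr i j a * tr i j a = 1)%g.
Proof.
apply: sp_ext => k; first by rewrite sp_permM sp_perm1 /= tpermK.
rewrite sp_signM sp_sign1 !tr_sign /=.
by case: tpermP => [->|->|/eqP/negbTE-> /eqP/negbTE->]; rewrite ?eqxx ?orbT ?andbT ?addbb ?andbF.
Qed.

Definition proper_tr i j a := (i != j) || a.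

Lemma tr_eq1 i j a : (tr i j a == 1%g) = ~~ proper_tr i j a.
Proof.
rewrite /proper_tr; apply/eqP/idP => [E|].
  have := sp_perm1 i; rewrite -E tr_id => ->; rewrite eqxx /=.
  by have := sp_sign1 i; rewrite -E tr_sign eqxx andbT => ->.
rewrite negb_or negbK => /andP[/eqP-> /negbTE->].
by apply: sp_ext => k; rewrite ?sp_perm1 ?sp_sign1 ?tr_sign //= tperm1 perm1.
Qed.

Lemma tr_stab (V : zmodType) (c : 'I_n -> V) i j a :
  (tr i j a \in stab c) = lrel c i j a.
Proof.
apply/stabP/idP => [/(_ i)|cij k]; first by rewrite tr_id tr_sign eqxx andbT.
rewrite tr_sign /=; case: tpermP => [->|->|/eqP/negbTE-> /eqP/negbTE->].
- by rewrite eqxx andbT.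
- by rewrite eqxx orbT andbT lrel_sym.
- by rewrite andbF lrel_refl.
Qed.

Lemma tr_WD i j a : (tr i j a \in WD n) = (i != j) || ~~ a.
Proof.
rewrite inE /sp_odd; case: a; last first.
  by rewrite orbT eq_card0 // => k; rewrite inE tr_sign.
rewrite (_ : [set k | _] = [set i; j]) ?cards2 ?orbF; first by case: eqP.
by apply/setP=> k; rewrite !inE tr_sign.
Qed.

End SignedTranspositions.

(** In a rank factorization each entry is a product of a row factor and a column factor, so the 2 x
    2 minors vanish. *)
Lemma rank1_minor (F : fieldType) m n (A : 'M[F]_(m, n)) i j k l :
  (\rank A <= 1)%N -> A i j * A k l = A i l * A k j.
Proof.
move=> r1; rewrite -(mulmx_base A); move: (\rank A) r1 (col_base A) (row_base A).
move=> r r1 C D; rewrite !mxE.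
case: r r1 C D => [|[|r]] // _ C D; first by rewrite !big_ord0 !mul0r.
by rewrite !big_ord1 mulrACA [D _ j * _]mulrC -mulrACA.
Qed.

Section Reflections.

Variables (R : realType) (n : nat) (G : {group signed_perm n}).
Variable rG : mx_representation R G n.
Hypothesis rGE : forall w, rG w = sp_mx R w.
Implicit Types (i j k : 'I_n) (a b : bool) (u v w : signed_perm n).

Let disp w : 'M[R]_n := sp_mx R w - 1%:M.

Let dispE w k l :
  disp w k l = (-1) ^+ sp_sign w k *+ (sp_perm w k == l) - (k == l)%:R.
Proof. by rewrite !mxE. Qed.

Let disp_diag w k :
  (disp w k k == 0) = (sp_perm w k == k) && ~~ sp_sign w k.
Proof.
rewrite dispE eqxx; case: (sp_perm w k =P k) => _; last by rewrite mulr0n mulr1n sub0r oppr_eq0 oner_eq0.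
case: (sp_sign w k); rewrite !mulr1n ?expr0 ?subrr ?eqxx //.
by rewrite -opprD oppr_eq0 -(natrD _ 1 1) pnatr_eq0.
Qed.

Let disp_off w k l : k != l -> disp w k l != 0 -> sp_perm w k = l.
Proof.
by rewrite dispE => /negbTE->; rewrite subr0; case: (sp_perm w k =P l); rewrite ?mulr0n ?eqxx.
Qed.

(** A diagonal entry of w - 1 is nonzero exactly when [w] does not fix that basis vector. If two are
    nonzero, vanishing of their minor makes the off-diagonal entries nonzero, so [w] swaps the two
    coordinates; hence at most two are moved. The same minor shows that the two signs agree. *)
Lemma rank1_tr w : \rank (disp w) = 1%N ->
  exists i j a, proper_tr i j a /\ w = tr i j a.
Proof.
move=> r1; have minor i j k l := @rank1_minor _ _ _ (disp w) i j k l (eq_leq r1).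
have [i iw|w1] := pickP (fun i => disp w i i != 0); last first.
  suff w0 : disp w = 0 by rewrite w0 mxrank0 in r1.
  apply/matrixP=> k l; rewrite dispE mxE.
  have /negbFE := w1 k; rewrite disp_diag => /andP[/eqP-> /negbTE->].
  by rewrite expr0 subrr.
have moved k : k != i -> disp w k k != 0 -> sp_perm w i = k /\ sp_perm w k = i.
  move=> ki kw; have : disp w i i * disp w k k != 0 by rewrite mulf_neq0.
  rewrite minor mulf_eq0 negb_or => /andP[ik kk].
  by split; apply: disp_off; rewrite // eq_sym.
exists i, (sp_perm w i), (sp_sign w i); have [ii|ni] := eqVneq (sp_perm w i) i.
  have iS : sp_sign w i by move: iw; rewrite disp_diag ii eqxx negbK.
  rewrite /proper_tr iS orbT; split=> //.
  have fixd k : k != i -> (sp_perm w k == k) && ~~ sp_sign w k.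
    move=> ki; rewrite -disp_diag; apply/negPn/negP => /(moved _ ki)[E].
    by rewrite -E ii eqxx in ki.
  apply: sp_ext => k; rewrite ?tr_sign /= ?ii ?tperm1 ?perm1.
    by have [->|/fixd/andP[/eqP]] := eqVneq k i.
  by have [->|/fixd/andP[_ /negbTE]] := eqVneq k i.
rewrite /proper_tr eq_sym ni; split=> //; set j := sp_perm w i in ni *.
have jw : disp w j j != 0.
  by rewrite disp_diag /j (inj_eq perm_inj) (negbTE ni).
have [_ ji] := moved j ni jw.
have fixd k : k != i -> k != j -> (sp_perm w k == k) && ~~ sp_sign w k.
  move=> ki kj; rewrite -disp_diag; apply/negPn/negP => /(moved _ ki)[E _].
  by rewrite -E eqxx in kj.
have sij : sp_sign w j = sp_sign w i.
  have := minor i i j j; rewrite !dispE -/j ji !eqxx [i == j]eq_sym !(negbTE ni).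
  rewrite !subr0 !mulr0n !mulr1n !sub0r mulrNN mulr1.
  case: (sp_sign w i); case: (sp_sign w j); rewrite // ?expr0 ?expr1 ?mul1r ?mulr1 => /eqP.
    by rewrite -subr_eq0 opprK -(natrD _ 1 1) pnatr_eq0.
  by rewrite -subr_eq0 opprK -(natrD _ 1 1) pnatr_eq0.
apply: sp_ext => k; rewrite ?tr_sign /=.
  case: tpermP => [->|->|/eqP ki /eqP kj] //.
  by have /andP[/eqP] := fixd k ki kj.
have [->|ki] := eqVneq k i; first by rewrite andbT.
have [->|kj] := eqVneq k j; first by rewrite andbT.
by have /andP[_ /negbTE->] := fixd k ki kj; rewrite andbF.
Qed.

Lemma is_reflectionP w :
  reflect (exists i j a, proper_tr i j a /\ w = tr i j a) (is_reflection rG w).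
Proof.
rewrite /is_reflection rGE; apply: (iffP andP) => [[_ /eqP]|]; first exact: rank1_tr.
move=> [i [j [a [pr ->]]]]; split.
  apply/eqP/nt_prime_order => //; first by rewrite expgS expg1 tr_involutive.
  by rewrite tr_eq1 negbK.
rewrite -/(disp _) eqn_leq; apply/andP; split; last first.
  rewrite lt0n mxrank_eq0; apply: contraTneq pr => d0.
  rewrite /proper_tr negb_or.
  have /eqP : disp (tr i j a) i i = 0 by rewrite d0 mxE.
  by rewrite disp_diag tr_id tr_sign eqxx andbT eq_sym negbK.
(* All rows of this matrix are multiples of row [i]. *)
apply: leq_trans (rank_leq_row (row i (disp (tr i j a)))).
apply/mxrankS/row_subP => k.
have [->|ki] := eqVneq k i; first exact: submx_refl.
have [->|kj] := eqVneq k j.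
  rewrite (_ : row j _ = (- (-1) ^+ a) *: row i (disp (tr i j a))) ?scalemx_sub //.
  apply/rowP=> l; rewrite !mxE -!/(disp _) !tr_sign !eqxx orbT andbT /= tpermL tpermR.
  by case: (a); rewrite ?expr0 ?expr1; case: (i == l); case: (j == l); rewrite ?mulr0n ?mulr1n; lra.
rewrite (_ : row k _ = 0) ?sub0mx //; apply/rowP=> l.
by rewrite !mxE tr_sign (negbTE ki) (negbTE kj) andbF tpermD 1?eq_sym // expr0 subrr.
Qed.

End Reflections.

(** * Direct factors of a stabilizer *)

Section Decomposition.

Variables (R : realType) (n : nat) (G : {group signed_perm n}).
Variable rG : mx_representation R G n.
Hypothesis rGE : forall w, rG w = sp_mx R w.
Hypothesis GBD : G = WB n \/ G = WD n.
Implicit Types (i j k : 'I_n) (a b : bool) (u v w : signed_perm n).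
Implicit Types (c : 'I_n -> int) (H K L : {group signed_perm n}).

Definition gstab c : {group signed_perm n} := (G :&: stab c)%G.

Lemma tr_G i j a : i != j -> tr i j a \in G.
Proof. by move=> ij; case: GBD => ->; [rewrite inE|rewrite tr_WD ij]. Qed.

Lemma tr_gstab c i j a : i != j -> (tr i j a \in gstab c) = lrel c i j a.
Proof. by move=> ij; rewrite inE tr_G // tr_stab. Qed.

Lemma tr_reflection i j a : proper_tr i j a -> is_reflection rG (tr i j a).
Proof. by move=> pr; apply/is_reflectionP => //; exists i, j, a. Qed.

(* Multiplying w by a reflection of the group sending w e_i back to e_i shrinks *)
(* the support; in type D sign changes have to be removed two at a time.        *)
Lemma gstab_reflections c : reflection_subgroup rG (gstab c).
Proof.
rewrite /reflection_subgroup subsetIl andTb eqEsubset gen_subG; apply/andP; split.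
  by apply/subsetP=> w; rewrite inE => /andP[].
pose T := <<[set w in gstab c | is_reflection rG w]>>%G.
change (gstab c \subset T).
have trT i j a : i != j -> lrel c i j a -> tr i j a \in T.
  move=> ij cij; apply: mem_gen; rewrite inE tr_gstab // cij.
  by apply: tr_reflection; rewrite /proper_tr ij.
pose supp w := [set k | (sp_perm w k != k) || sp_sign w k].
apply/subsetP=> w; have [m] := ubnP #|supp w|; elim: m w => // m IHm w sw wH.
have IH i v : i \in supp w -> i \notin supp (w * v)%g ->
    (forall k, k \notin supp w -> k \notin supp v) -> v \in T -> w \in T.
  move=> iw ivw vw vT; rewrite -(mulgK v w) groupM ?groupV //; apply: IHm; last first.
    rewrite groupM // (subsetP _ _ vT) // gen_subG.
    by apply/subsetP=> x; rewrite inE => /andP[].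
  rewrite ltnS in sw; apply: leq_trans sw; apply/proper_card/properP; split; last by exists i.
  apply/subsetP=> k; apply: contraTT => kw; have := vw k kw; move: kw.
  rewrite !inE sp_permM sp_signM !negb_or !negbK => /andP[/eqP-> /negbTE->].
  by case/andP => /eqP -> /negbTE->; rewrite eqxx.
have /setIP[wG /stabP cw] := wH.
have [i iw|s1] := pickP (fun i => sp_perm w i != i).
  set j := sp_perm w i in iw; have ij : i != j by rewrite eq_sym.
  apply: (IH i (tr i j (sp_sign w i))); last exact/trT/cw.
  - by rewrite inE -/j iw.
  - by rewrite inE sp_permM sp_signM -/j tr_sym tr_id tr_sign !eqxx andbT addbb.
  - move=> k; rewrite !inE tr_sign /= !negb_or !negbK => /andP[/eqP kk kS].
    have ki : k != i by apply: contraNneq iw => ki; rewrite /j -ki kk.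
    have kj : k != j by apply: contraNneq ki => kj; rewrite -(inj_eq (@perm_inj _ (sp_perm w))) kk kj.
    have tk : tperm i j k = k by rewrite tpermD // eq_sym.
    by rewrite tk eqxx (negbTE ki) (negbTE kj) andbF.
have {}s1 k : sp_perm w k = k by apply/eqP/negbFE/s1.
have [i iw|e1] := pickP (sp_sign w); last first.
  rewrite (_ : w = 1%g) ?group1 //.
  by apply: sp_ext => k; rewrite ?sp_perm1 ?sp_sign1 ?e1.
have ci : lrel c i i true by have := cw i; rewrite s1 iw.
have iS : i \in supp w by rewrite inE iw orbT.
have [tG|tG] := boolP (tr i i true \in G).
  apply: (IH i (tr i i true)) => //.
  - by rewrite inE sp_permM sp_signM s1 iw tr_id tr_sign !eqxx.
  - move=> k; rewrite !inE s1 eqxx tr_sign /= tperm1 perm1 eqxx orbb.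
    by apply: contra => /eqP->.
  apply: mem_gen; rewrite inE tr_reflection /proper_tr ?orbT // andbT.
  by rewrite inE tG tr_stab.
(* Were [i] the only negated coordinate, [w] would be its sign change, which is not in [G]. *)
have [j /andP[ji jw]] : exists j, (j != i) && sp_sign w j.
  apply/existsP; apply: contraR tG; rewrite negb_exists => /forallP jw.
  suff -> : tr i i true = w by [].
  apply: sp_ext => k; rewrite ?tr_sign /= ?tperm1 ?perm1 ?s1 // orbb.
  have [->|ki] := eqVneq k i; first by rewrite iw.
  by apply/esym/negbTE; have := jw k; rewrite ki.
have cj : lrel c j j true by have := cw j; rewrite s1 jw.
have cij a : lrel c i j a.
  by move: ci cj; rewrite /lrel; case: a => /eqP Ei /eqP Ej; apply/eqP; lia.
have ij : i != j by rewrite eq_sym.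
apply: (IH i (tr i j false * tr i j true)%g) => //; last by rewrite groupM // trT.
  rewrite inE !sp_permM !sp_signM s1 iw !tr_id !tr_sign !eqxx orbT.
  by rewrite [tr i j true]tr_sym tr_id eqxx.
move=> k; rewrite !inE s1 eqxx sp_permM sp_signM !tr_sign /= => kw.
have ki : k != i by apply: contraNneq kw => ->.
have kj : k != j by apply: contraNneq kw => ->.
have tk : tperm i j k = k by rewrite tpermD // eq_sym.
by rewrite !tk (negbTE ki) (negbTE kj) eqxx.
Qed.

Lemma reflection_subgroupP H K : reflection_subgroup rG H ->
  reflect (forall i j a, proper_tr i j a -> tr i j a \in H -> tr i j a \in K)
    (H \subset K).
Proof.
case/andP=> _ /eqP defH; apply: (iffP idP) => [/subsetP HK i j a _|HK]; first exact: HK.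
rewrite -defH gen_subG; apply/subsetP=> w; rewrite inE => /andP[wH].
by case/(is_reflectionP rGE) => i [j [a [pr E]]]; rewrite E in wH *; apply: HK.
Qed.

Lemma gstab_subP c K :
  reflect (forall i j a, proper_tr i j a -> tr i j a \in gstab c -> tr i j a \in K)
    (gstab c \subset K).
Proof. exact: reflection_subgroupP (gstab_reflections c). Qed.

Definition zero_set c := [set i | c i == 0].

Lemma zero_lrel c i j a b : a != b -> lrel c i j a -> lrel c i j b -> c i = 0 /\ c j = 0.
Proof. by rewrite /lrel; case: a; case: b => // _ /eqP + /eqP; lia. Qed.

Lemma zero_lrelP c i j a : c i = 0 -> lrel c i j a = (c j == 0).
Proof. by rewrite /lrel => ->; rewrite oppr0 if_same. Qed.

Definition moved H := [set i | [exists j, [exists a, proper_tr i j a && (tr i j a \in H)]]].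

Lemma movedP H i : reflect (exists j a, proper_tr i j a /\ tr i j a \in H) (i \in moved H).
Proof.
rewrite inE; apply: (iffP existsP) => [[j /existsP[a /andP[? ?]]]|[j [a [p t]]]].
  by exists j, a.
by exists j; apply/existsP; exists a; rewrite p.
Qed.

(** The reflections generating [H] preserve the labelling that is 0 on [moved H] and has singleton
    blocks elsewhere, so all of [H] does. *)
Lemma fixed_off_moved H k w : reflection_subgroup rG H ->
  k \notin moved H -> w \in H -> sp_perm w k = k /\ ~~ sp_sign w k.
Proof.
move=> Hr kH wH; have : w \in stab (lres (fun=> 0%:Z) (moved H)).
  move: wH; apply/subsetP/(reflection_subgroupP _ Hr) => x y d pxy tH.
  have xH : x \in moved H by apply/movedP; exists y, d.
  have yH : y \in moved H.
    by apply/movedP; exists x, d; rewrite tr_sym /proper_tr eq_sym.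
  by rewrite tr_stab lresE xH yH zero_lrelP.
by move/stabP/(_ k); rewrite lresE (negbTE kH) => /andP[/eqP<-].
Qed.

(* For #|zero_set c| = 2 the group D_2 = A_1 x A_1 splits although its two    *)
(* reflections move the same coordinates.                                     *)
Definition no_D2_block c := G = WB n \/ #|zero_set c| != 2%N.

Section Factor.

Variables (c : 'I_n -> int) (K L : {group signed_perm n}).
Hypothesis cG : no_D2_block c.
Hypothesis Kr : reflection_subgroup rG K.
Hypothesis Lr : reflection_subgroup rG L.
Hypothesis KxL : (K \x L)%g = gstab c.

Let KsubG : K \subset gstab c. Proof. by have /dprodP[_ <- _ _] := KxL; apply: mulG_subl. Qed.
Let LsubG : L \subset gstab c. Proof. by have /dprodP[_ <- _ _] := KxL; apply: mulG_subr. Qed.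
Let KnormG : gstab c \subset 'N(K)%g. Proof. by have /dprod_normal2[/andP[]] := KxL. Qed.
Let KL1 w : w \in K -> w \in L -> w = 1%g.
Proof. by move=> wK wL; have /dprodP[_ _ _ I] := KxL; apply/set1gP; rewrite -I inE wK. Qed.
Let KLcom u v : u \in K -> v \in L -> (u ^ v)%g = u.
Proof. by move=> uK vL; have /dprodP[_ _ /centsP C _] := KxL; apply/conjg_fixP/commgP/esym/C. Qed.

(** Both relations together force c i = c j = 0. The conjugating element is the sign change of e_i
    in type B; otherwise it negates e_i and e_k, where [k] is a third zero coordinate. *)
Lemma opposite_tr_conj i j a : i != j -> lrel c i j a -> lrel c i j (~~ a) ->
  exists2 w, w \in gstab c & (tr i j a ^ w)%g = tr i j (~~ a).
Proof.
move=> ij ca cna; have [ci cj] : c i = 0 /\ c j = 0 by apply: zero_lrel ca cna; case: (a).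
case: cG => [GB|Z2].
  exists (tr i i true); first by rewrite inE tr_stab zero_lrelP // ci GB inE eqxx.
  rewrite trJ !tr_sign /= tperm1 !perm1 !eqxx eq_sym (negbTE ij) /=; congr tr.
  by case: (a).
have [k kZ /andP[ki kj]] : exists2 k, c k = 0 & (k != i) && (k != j).
  have ijZ : [set i; j] \subset zero_set c.
    by apply/subsetP=> k; rewrite !inE => /orP[] /eqP->; rewrite ?ci ?cj.
  have : ~~ (zero_set c \subset [set i; j]).
    apply: contra Z2 => Zij; have /eqP -> : zero_set c == [set i; j] by rewrite eqEsubset Zij.
    by rewrite cards2 ij.
  by case/subsetPn=> k; rewrite !inE negb_or => /eqP; exists k.
have ik : i != k by rewrite eq_sym.
exists (tr i k false * tr i k true)%g.
  by rewrite groupM // tr_gstab // zero_lrelP // kZ.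
have kj' : tperm i k j = j by rewrite tpermD // eq_sym.
rewrite conjgM !trJ !tr_sign /= kj' tpermL tpermR kj' !eqxx orbT !addbF.
by rewrite eq_sym (negbTE ij) eq_sym (negbTE kj) addbT addbF.
Qed.

(** A reflection of [K] and one of [L] commute and are distinct. If both move [i], they must be
    [tr i j a] and [tr i j (~~ a)] with [i] different from [j]. These are conjugate in the
    stabilizer, where [K] is normal, so the second lies in both factors, which is impossible. *)
Lemma moved_disjoint i : i \in moved K -> i \in moved L -> False.
Proof.
case/movedP=> j [a [pt tK]] /movedP[l [b [pu uL]]].
have E := KLcom tK uL; rewrite trJ tr_id in E.
have tu : tr i j a <> tr i l b.
  by move=> tu; move: pt; rewrite -[proper_tr _ _ _]negbK -tr_eq1 (KL1 tK) ?eqxx ?tu.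
have [li|li] := eqVneq l i.
  have bT : b by move: pu; rewrite /proper_tr li eqxx.
  have := congr1 (fun w => sp_sign w i) E; rewrite !tr_sign li bT /= tperm1 !perm1 !eqxx !orbT !andbT /= orbb.
  have [ji|_] := eqVneq j i; last by case: (a).
  move=> _; case: tu; rewrite li bT ji; move: pt; rewrite /proper_tr ji eqxx /= => ->.
  by [].
have lj : l = j.
  apply/eqP; apply: contraT => lj.
  have jl : tperm i j l = l by rewrite tpermD // eq_sym.
  have := congr1 (fun w => sp_perm w l) E; rewrite tr_id /= jl => El.
  have ji : j = i by apply: (@perm_inj _ (tperm i l)); rewrite El tpermL.
  have aT : a by move: pt; rewrite /proper_tr ji eqxx.
  have := congr1 (fun w => sp_sign w l) E.
  by rewrite !tr_sign ji aT !eqxx (negbTE li) /=; case: (b).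
rewrite lj in li uL tu; have ij : i != j by rewrite eq_sym.
have ab : b = ~~ a by move: tu; case: (a); case: (b).
have := subsetP KsubG _ tK; have := subsetP LsubG _ uL; rewrite !tr_gstab // ab => cna ca.
have [w wH wE] := opposite_tr_conj ij ca cna.
have : (tr i j a ^ w)%g \in K by rewrite memJ_norm // (subsetP KnormG).
rewrite wE -ab => uK; have := KL1 uK uL.
by move/eqP; rewrite tr_eq1 /proper_tr ij.
Qed.

(** Conjugation by [tr i j a] preserves the normal subgroup [K] and turns its reflections moving [i]
    into reflections moving [j]. *)
Lemma moved_closed i j a : i \in moved K -> lrel c i j a -> j \in moved K.
Proof.
have [->|ij] // := eqVneq i j.
case/movedP=> k [b [pr tK]] cij; have tH : tr i j a \in gstab c by rewrite tr_gstab.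
have : (tr i k b ^ tr i j a)%g \in K by rewrite memJ_norm // (subsetP KnormG).
move: pr; rewrite -[proper_tr _ _ _]negbK -tr_eq1 -(conjg_eq1 _ (tr i j a)).
by rewrite trJ tr_id tr_eq1 negbK => pr tK'; apply/movedP; do 2!eexists; split; eauto.
Qed.

(** Write a reflection with both indices in [moved K] as u v with u in [K] and v in [L]. Off
    [moved L], v is trivial; on [moved L], which is disjoint from [moved K], both u and the
    reflection are trivial. So v = 1. *)
Lemma factor_gstab : K = gstab (lres c (moved K)).
Proof.
apply/val_inj/eqP; rewrite eqEsubset; apply/andP; split.
  apply/(reflection_subgroupP _ Kr) => i j a pr tK.
  have /setIP[tG] := subsetP KsubG _ tK; rewrite tr_stab => cij.
  have iK : i \in moved K by apply/movedP; exists j, a.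
  by rewrite inE tG tr_stab lresE iK (moved_closed iK cij).
apply/(gstab_subP _ _) => i j a pr; rewrite inE tr_stab lresE => /andP[tG].
have [/andP[iK jK] cij|_] := boolP (_ && _); last first.
  by move: pr; rewrite /proper_tr => /orP[/negbTE->|->]; rewrite ?andbF.
have: tr i j a \in gstab c by rewrite inE tG tr_stab.
have /dprodP[_ <- _ _] := KxL => /mulsgP[u v uK vL def_t].
have vK : v = (u^-1 * tr i j a)%g by rewrite def_t mulKg.
suff v1 : v = 1%g by rewrite def_t v1 mulg1.
have vfix k : sp_perm v k = k /\ sp_sign v k = false.
  have [kL|kL] := boolP (k \in moved L); last by have [-> /negbTE->] := fixed_off_moved Lr kL vL.
  have kK : k \notin moved K by apply/negP => /moved_disjoint/(_ kL).
  have [up us] := fixed_off_moved Kr kK (groupVr uK).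
  rewrite vK sp_permM sp_signM up (negbTE us) tr_sign /=.
  have ki : k != i by apply: contraNneq kK => ->.
  have kj : k != j by apply: contraNneq kK => ->.
  have tk : tperm i j k = k by rewrite tpermD // eq_sym.
  by rewrite tk (negbTE ki) (negbTE kj) andbF.
by apply: sp_ext => k; have [p s] := vfix k; rewrite ?sp_perm1 ?sp_sign1.
Qed.

End Factor.

End Decomposition.

(** * Ranks *)

(** For a rank factorization P = C D, cancelling in C D C D = C D gives D C = 1, whose trace is the
    rank. *)
Lemma rank_idempotent (F : fieldType) n (P : 'M[F]_n) :
  P *m P = P -> (\rank P)%:R = \tr P.
Proof.
move=> PP; pose C := col_base P; pose D := row_base P.
have CD : C *m D = P := mulmx_base P.
suff DC : D *m C = 1%:M by rewrite -[in RHS]CD mxtrace_mulC DC mxtrace1.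
apply: (row_full_inj (col_base_full P)); rewrite mulmx1.
apply: (row_free_inj (row_base_free P)).
by rewrite -/C -/D mulmxA CD -mulmxA CD PP.
Qed.

(** * Block sizes, coranks and parity *)

Section Blocks.

Variable n : nat.
Implicit Types (i j k : 'I_n) (a b : bool) (c : 'I_n -> int).

Definition blk c i := [set j | lrel c i j false || lrel c i j true].

Lemma blkP c i j : reflect (exists a, lrel c i j a) (j \in blk c i).
Proof.
rewrite inE; apply: (iffP orP) => [[h|h]|[[] h]]; first by exists false.
- by exists true.
- by right.
- by left.
Qed.

Lemma blk_refl c i : i \in blk c i.
Proof. by apply/blkP; exists false; apply: lrel_refl. Qed.

Lemma blk_eq c i j : j \in blk c i -> blk c j = blk c i.
Proof.
case/blkP=> a cij; apply/setP=> k; apply/blkP/blkP => [] [b h].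
  by exists (a (+) b); apply: lrel_trans cij h.
by exists (a (+) b); apply: lrel_trans h; rewrite lrel_sym.
Qed.

Lemma blk_zero c i : c i = 0 -> blk c i = zero_set c.
Proof. by move=> ci; apply/setP=> j; rewrite !inE !zero_lrelP // orbb. Qed.

Lemma lrel_zero c i j a : lrel c i j a -> (c i == 0) = (c j == 0).
Proof. by rewrite /lrel; case: a => /eqP->; rewrite ?oppr_eq0. Qed.

Definition blocks c : {set {set 'I_n}} := [set blk c i | i in ~: zero_set c].

Lemma sum_blocks (V : nmodType) c (F : {set 'I_n} -> V) :
  \sum_(i | c i != 0) F (blk c i) = \sum_(B in blocks c) F B *+ #|B|.
Proof.
rewrite (partition_big (blk c) (mem (blocks c))) /=; last first.
  by move=> i ci; apply: imset_f; rewrite !inE.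
apply: eq_bigr => B /imsetP[i]; rewrite !inE => ci ->.
rewrite -sumr_const; apply: eq_big => [j|j /andP[_ /eqP->]] //.
apply/andP/idP => [[_ /eqP<-]|ji]; first exact: blk_refl.
by rewrite (blk_eq ji); case/blkP: ji => a /lrel_zero <-.
Qed.

Lemma card_blocks (F : numFieldType) c :
  #|blocks c|%:R = \sum_(i | c i != 0) (#|blk c i|%:R)^-1 :> F.
Proof.
rewrite (sum_blocks c (fun B => #|B|%:R^-1)) -sumr_const.
apply: eq_bigr => B /imsetP[i _ ->]; rewrite -[RHS]mulr_natr mulVf //.
by rewrite pnatr_eq0 -lt0n; apply/card_gt0P; exists i; apply: blk_refl.
Qed.

Lemma leq_card_blocks c : (#|blocks c| <= n)%N.
Proof. by rewrite (leq_trans (leq_imset_card _ _)) // (leq_trans (max_card _)) ?card_ord. Qed.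

(** Spreading each block over its members with weight 1/|B| lets coranks be compared coordinate by
    coordinate. *)
Lemma corank_blocks (F : numFieldType) c :
  (n - #|blocks c|)%:R = \sum_i (if c i == 0 then 1 else 1 - (#|blk c i|%:R)^-1) :> F.
Proof.
have nE : n%:R = \sum_(i < n) 1 :> F by rewrite sumr_const card_ord.
rewrite natrB ?leq_card_blocks // (card_blocks F) nE [X in _ - X]big_mkcond -sumrB; apply: eq_bigr => i _.
by case: eqP; rewrite ?subr0.
Qed.

(** A zero block of size k contributes rank k and a nonzero one rank k - 1, so the former must have
    even and the latter odd size. *)
Definition even_label c := [forall i, odd #|blk c i| == (c i != 0)].

Lemma even_zero_set c : even_label c -> ~~ odd #|zero_set c|.
Proof.
move/forallP=> ev; have [->|[i iZ]] := set_0Vmem (zero_set c); first by rewrite cards0.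
move: iZ; rewrite inE => /eqP ci.
by have := ev i; rewrite (blk_zero ci) ci eqxx => /eqP->.
Qed.

Lemma even_corank c : even_label c -> ~~ odd (n - #|blocks c|).
Proof.
move=> evc; have /forallP ev := evc; rewrite oddB ?leq_card_blocks //.
have -> : odd n = odd #|zero_set c| (+) odd #|~: zero_set c|.
  by rewrite -oddD cardsC card_ord.
rewrite (negbTE (even_zero_set evc)).
suff -> : odd #|~: zero_set c| = odd #|blocks c| by rewrite addbb.
have -> : #|~: zero_set c| = (\sum_(B in blocks c) #|B|)%N.
  rewrite -sum1_card (eq_bigl (fun i => c i != 0)) => [|i]; last by rewrite !inE.
  by rewrite (sum_blocks c (fun=> 1%N)); apply: eq_bigr => B _; rewrite natn.
rewrite -sum1_card !(big_morph odd oddD (erefl _)); apply: eq_bigr => B.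
case/imsetP=> i; rewrite !inE => ci ->.
by have /eqP-> := ev i.
Qed.

Lemma lres_zero c (X : {set 'I_n}) i : (lres c X i == 0) = (i \in X) && (c i == 0).
Proof. by rewrite -lrel_int0 lresE andbb lrel_int0; case: ifP; rewrite ?eqxx. Qed.

Definition closed_under c (X : {set 'I_n}) :=
  forall i j a, i \in X -> lrel c i j a -> j \in X.

Lemma blk_lres c X i : closed_under c X ->
  blk (lres c X) i = if i \in X then blk c i else [set i].
Proof.
move=> clX; apply/setP=> j; rewrite inE !lresE /=.
have [iX|iX] /= := boolP (i \in X); last by rewrite andbF andbT orbF inE eq_sym.
rewrite inE; have [jX|jX] //= := boolP (j \in X).
rewrite andbF orbF andbT [RHS](_ : _ = false); first by apply: contraNF jX => /eqP<-.
by apply: contraNF jX => /orP[]; apply: clX.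
Qed.

Lemma closed_blk c i : closed_under c (blk c i).
Proof.
move=> j k a /blkP[b cij] cjk; apply/blkP; exists (b (+) a).
exact: lrel_trans cij cjk.
Qed.

Lemma even_lres c X : closed_under c X -> even_label c -> even_label (lres c X).
Proof.
move=> clX /forallP ev; apply/forallP=> i; rewrite blk_lres // lres_zero.
by have := ev i; case: ifP => // _ _; rewrite cards1.
Qed.

Lemma corank_lres_blk c i :
  (n - #|blocks (lres c (blk c i))| = #|blk c i| - (c i != 0))%N.
Proof.
set X := blk c i; apply/eqP; rewrite -(eqr_nat rat) corank_blocks; apply/eqP.
have X0 : (0 < #|X|)%N by apply/card_gt0P; exists i; apply: blk_refl.
have clX := @closed_blk c i.
rewrite (bigID (mem X)) /= [X in _ + X]big1 ?addr0; last first.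
  by move=> j jX; rewrite lres_zero blk_lres // (negbTE jX) cards1 invr1 subrr.
transitivity (\sum_(j in X) (if c i == 0 then 1 else 1 - #|X|%:R^-1 : rat)).
  apply: eq_bigr => j jX; rewrite lres_zero blk_lres // jX /= (blk_eq jX) -/X.
  by case/blkP: jX => a /lrel_zero ->.
rewrite sumr_const; case: eqP => _; rewrite ?subn0 //.
rewrite natrB // -[LHS]mulr_natl mulrBr mulr1 mulfV // pnatr_eq0; lia.
Qed.

Lemma zero_set_lres c X : closed_under c X ->
  zero_set (lres c X) = zero_set c \/ zero_set (lres c X) = set0.
Proof.
move=> clX; have [E|[i]] := set_0Vmem (zero_set (lres c X)); first by right.
rewrite inE lres_zero => /andP[iX /eqP ci]; left; apply/setP=> j.
rewrite !inE lres_zero; have [cj|] := eqVneq (c j) 0; last by rewrite andbF.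
by rewrite (clX i j false iX) // zero_lrelP // cj.
Qed.

End Blocks.

(** * Parabolic subgroups as label stabilizers, and their ranks *)

Section Parabolic.

Variables (R : realType) (n : nat) (G : {group signed_perm n}).
Variable rG : mx_representation R G n.
Hypothesis rGE : forall w, rG w = sp_mx R w.
Hypothesis GBD : G = WB n \/ G = WD n.
Implicit Types (i j k : 'I_n) (a b : bool) (u v w : signed_perm n).
Implicit Types (c : 'I_n -> int) (H K L : {group signed_perm n}).

Lemma mul_sp_mx m (U : 'M[R]_(m, n)) w r i :
  (U *m sp_mx R w) r (sp_perm w i) = (-1) ^+ sp_sign w i * U r i.
Proof.
rewrite mxE (bigD1 i) //= big1 ?addr0; first by rewrite mxE eqxx mulr1n mulrC.
by move=> k ki; rewrite mxE (inj_eq perm_inj) (negbTE ki) mulr0n mulr0.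
Qed.

(** Right multiplication by [w] permutes the columns of [U] up to sign, so fixing [U] means
    preserving the labelling by columns. *)
Lemma sp_mx_fix m (U : 'M[R]_(m, n)) w :
  (U *m sp_mx R w == U) = (w \in stab (fun i => col i U)).
Proof.
apply/eqP/stabP => [E i|cw].
  apply/eqP/colP=> r; rewrite mxE -[in LHS]E mul_sp_mx.
  by case: (sp_sign w i); rewrite !mxE ?mul1r // expr1 mulN1r.
apply/matrixP=> r j; rewrite -(permKV (sp_perm w) j); set i := (_ j).
rewrite mul_sp_mx; have /eqP/colP/(_ r) := cw i.
by case: (sp_sign w i); rewrite !mxE => ->; rewrite ?mul1r // expr1 mulN1r.
Qed.

Lemma parabolic_label H : parabolic rG H -> exists c, H = gstab G c.
Proof.
case=> U HU; exists (int_label (fun i => col i U)); apply/group_inj; rewrite HU /gstab.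
have -> : stab (int_label (fun i => col i U)) = stab (fun i => col i U).
  apply: stab_eq => i j a; apply: int_labelE => x /eqP.
  by rewrite -subr_eq0 opprK -mulr2n -scaler_nat scaler_eq0 pnatr_eq0 => /eqP.
by apply/setP=> w; rewrite !inE rGE sp_mx_fix inE.
Qed.

(** The stabilizer of the labelling [c] is that of the single vector [c]; the witness repeats it in
    every row. *)
Lemma gstab_parabolic c : parabolic rG (gstab G c).
Proof.
exists (\matrix_(i, j) (c j)%:~R); set U := (\matrix_(i, j) _).
rewrite /gstab (_ : stab c = stab (fun i => col i U)).
  by apply/setP=> w; rewrite !inE rGE sp_mx_fix inE.
apply: stab_eq => i j a; rewrite /lrel; apply/eqP/eqP => [E|/colP/(_ i)].
  by apply/colP=> r; case: a E => E; rewrite !mxE E ?rmorphN.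
by case: a; rewrite !mxE -?rmorphN => /eqP; rewrite eqr_int => /eqP.
Qed.

Section Rank.

Variable c : 'I_n -> int.
(** In type D a zero block of size 1 carries no sign change, so its coordinate is fixed and would
    have to be counted as a nonzero singleton. *)
Hypothesis cZ : G = WB n \/ #|zero_set c| != 1%N.

(* P is the orthogonal projection on the fixed space, whose rank is read off   *)
(* its trace.                                                                  *)
Let s i j : R := (lrel c i j false)%:R - (lrel c i j true)%:R.
Let P : 'M[R]_n := \matrix_(i, j) (s i j / #|blk c i|%:R).

Let s_mul i j k a : lrel c i j a -> s k j = (-1) ^+ a * s k i.
Proof.
move=> cij; have E b : lrel c k j b = lrel c k i (a (+) b).
  apply/idP/idP => h; last by have := lrel_trans h cij; rewrite addbC addbA addbb.
  by rewrite addbC; apply: lrel_trans h _; rewrite lrel_sym.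
by rewrite /s !E; case: (a); rewrite /= ?mul1r // expr1 mulN1r opprB.
Qed.

Let s_zero i : c i = 0 -> forall j, s i j = 0.
Proof. by move=> ci j; rewrite /s !zero_lrelP // subrr. Qed.

Let s_lrel i j a : c i != 0 -> lrel c i j a -> s i j = (-1) ^+ a.
Proof.
move=> ci cij; rewrite (s_mul _ cij) /s lrel_refl lrel_int0 (negbTE ci).
by rewrite subr0 mulr1.
Qed.

Let P_fixed w : w \in gstab G c -> P *m rG w = P.
Proof.
case/setIP=> _ /stabP cw; apply/matrixP=> k j; rewrite rGE.
rewrite -(permKV (sp_perm w) j); set i := (_ j).
by rewrite mul_sp_mx !mxE (s_mul k (cw i)) mulrA.
Qed.

Let fixed_P m (U : 'M[R]_(m, n)) :
  (forall w, w \in gstab G c -> U *m rG w = U) -> U *m P = U.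
Proof.
move=> fU; have U_lrel i j a r : lrel c i j a -> i != j -> U r j = (-1) ^+ a * U r i.
  move=> cij ij; have := fU (tr i j a); rewrite tr_gstab // rGE => /(_ cij) E.
  by have := mul_sp_mx U (tr i j a) r i; rewrite E tr_id tr_sign eqxx andbT.
have U_zero i r : c i = 0 -> U r i = 0.
  have N1 (x : R) : x = - x -> x = 0 by lra.
  move=> ci; have [GB|Z1] : G = WB n \/ exists2 j, c j = 0 & j != i.
    case: cZ => [|Z1]; [by left|right].
    have : ~~ (zero_set c \subset [set i]).
      apply: contra Z1 => Zi; rewrite (_ : zero_set c = [set i]) ?cards1 //.
      by apply/eqP; rewrite eqEsubset Zi sub1set inE ci.
    by case/subsetPn=> j; rewrite !inE => /eqP; exists j.
  - have tG : tr i i true \in G by rewrite GB inE.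
    have := fU (tr i i true); rewrite inE tr_stab zero_lrelP // ci eqxx tG.
    move=> /(_ isT); rewrite rGE => E; apply: N1.
    have := mul_sp_mx U (tr i i true) r i.
    by rewrite E tr_id tr_sign eqxx expr1 mulN1r.
  - case: Z1 => j cj ji; have ij : i != j by rewrite eq_sym.
    have Ef : lrel c i j false by rewrite zero_lrelP // cj.
    have Et : lrel c i j true by rewrite zero_lrelP // cj.
    by have := U_lrel _ _ _ r Ef ij; have := U_lrel _ _ _ r Et ij; rewrite expr0 expr1; lra.
apply/matrixP=> r j; rewrite mxE; have [cj|cj] := eqVneq (c j) 0.
  rewrite U_zero // big1 // => i _; rewrite mxE /s.
  by rewrite ![lrel c i j _]lrel_sym !zero_lrelP // subrr mul0r mulr0.
rewrite (bigID (mem (blk c j))) /= [X in _ + X]big1 ?addr0 => [|i ij]; last first.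
  rewrite mxE (_ : s i j = 0) ?mul0r ?mulr0 // /s.
  move: ij; rewrite inE negb_or ![lrel c j i _]lrel_sym.
  by move=> /andP[/negbTE-> /negbTE->]; rewrite subrr.
transitivity (\sum_(i in blk c j) U r j / #|blk c j|%:R).
  apply: eq_bigr => i ij; rewrite mxE (blk_eq ij) mulrA; congr (_ / _).
  case/blkP: ij => a cji; have ci : c i != 0 by rewrite -(lrel_zero cji).
  rewrite (@s_lrel i j a) 1?lrel_sym //; have [E|ji] := eqVneq j i.
    move: cji; rewrite -E; case: (a); last by rewrite expr0 mulr1.
    by rewrite lrel_int0 (negbTE cj).
  by rewrite (U_lrel _ _ _ r cji ji) mulrC signrMK.
rewrite sumr_const -[LHS]mulr_natr divfK // pnatr_eq0 -lt0n.
by apply/card_gt0P; exists j; apply: blk_refl.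
Qed.

(** By [P_fixed] the rows of [P] are fixed vectors and by [fixed_P] it reproduces every fixed
    vector, so it is idempotent. Its diagonal is 1/|B| on a nonzero block B and 0 on the zero block;
    the trace counts the nonzero blocks. *)
Lemma rank_gstab : reflection_rank rG (gstab G c) = (n - #|blocks c|)%N.
Proof.
rewrite /reflection_rank; congr (n - _)%N; apply/eqP; rewrite -(eqr_nat R).
have -> : \rank (rfix_mx rG (gstab G c)) = \rank P.
  apply/eqP; rewrite eqn_leq; apply/andP; split; apply: mxrankS.
    by rewrite -(fixed_P (fun w wH => rfix_mx_id _ wH)) submxMl.
  by apply/rfix_mxP.
rewrite rank_idempotent ?fixed_P // (card_blocks R) big_mkcond; apply/eqP/eq_bigr => i _.
rewrite mxE; case: eqVneq => [ci|ci] /=; first by rewrite s_zero ?mul0r.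
by rewrite (s_lrel ci (lrel_refl _ _)) expr0 mul1r.
Qed.

End Rank.

End Parabolic.

(** * Even parabolic subgroups *)

Section Even.

Variables (R : realType) (n : nat) (G : {group signed_perm n}).
Variable rG : mx_representation R G n.
Hypothesis rGE : forall w, rG w = sp_mx R w.
Hypothesis GBD : G = WB n \/ G = WD n.
Implicit Types (i j k : 'I_n) (a b : bool) (u v w : signed_perm n).
Implicit Types (c : 'I_n -> int) (H K L : {group signed_perm n}).

Lemma tr_comm i j a k l b :
    [&& k != i, k != j, l != i & l != j] \/ (k = i /\ l = j) ->
  (tr i j a ^ tr k l b)%g = tr i j a.
Proof.
rewrite trJ => -[/and4P[ki kj li lj]|[-> ->]]; last first.
  rewrite !tr_sign /= tpermL tpermR !eqxx orbT andbT -addbA addbb addbF.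
  exact: tr_sym.
rewrite !tr_sign /= !tpermD // ![i == _]eq_sym ![j == _]eq_sym.
by rewrite (negbTE ki) (negbTE kj) (negbTE li) (negbTE lj) !andbF !addbF.
Qed.

Section DirectProduct.

Variables c c1 c2 : 'I_n -> int.
Hypothesis c1c : forall i j a, lrel c1 i j a -> lrel c i j a.
Hypothesis c2c : forall i j a, lrel c2 i j a -> lrel c i j a.
Hypothesis c12 : forall i j a, lrel c1 i j a -> lrel c2 i j a -> ~~ proper_tr i j a.
Hypothesis c_cover : forall i j a, proper_tr i j a -> tr i j a \in gstab G c ->
  lrel c1 i j a || lrel c2 i j a.
Hypothesis c_comm : forall i j k l a b,
    proper_tr i j a -> proper_tr k l b -> lrel c1 i j a -> lrel c2 k l b ->
  (tr i j a ^ tr k l b)%g = tr i j a.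

(** Stabilizers are generated by reflections, so commutation and generation are tested on
    reflections; the intersection is handled one coordinate at a time. *)
Lemma dprod_gstab : (gstab G c1 \x gstab G c2)%g = gstab G c.
Proof.
have cent12 : gstab G c2 \subset 'C(gstab G c1)%g.
  rewrite centsC; apply/(gstab_subP rGE GBD) => i j a pr /setIP[_]; rewrite tr_stab => ca.
  rewrite -sub_cent1; apply/(gstab_subP rGE GBD) => k l b pr' /setIP[_]; rewrite tr_stab => cb.
  by apply/cent1P/esym/commgP/conjg_fixP/c_comm.
have I12 : (gstab G c1 :&: gstab G c2 = 1)%g.
  apply/trivgP/subsetP=> w /setIP[/setIP[_ /stabP w1] /setIP[_ /stabP w2]].
  apply/set1gP/sp_ext => i; have := c12 (w1 i) (w2 i); rewrite negb_or negbK.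
    by rewrite sp_perm1 => /andP[/eqP<-].
  by rewrite sp_sign1 => /andP[_ /negbTE].
rewrite dprodEY //; apply/eqP; rewrite eqEsubset join_subG.
rewrite -andbA; apply/and3P; split; try by apply/setIS/stab_sub.
apply/(gstab_subP rGE GBD) => i j a pr tc; have /setIP[tG _] := tc.
have /orP[h|h] := c_cover pr tc.
  by apply: (subsetP (joing_subl _ _)); rewrite inE tG tr_stab.
by apply: (subsetP (joing_subr _ _)); rewrite inE tG tr_stab.
Qed.

End DirectProduct.

Lemma dprod_lres c X : closed_under c X ->
  (gstab G (lres c X) \x gstab G (lres c (~: X)))%g = gstab G c.
Proof.
move=> clX; have sub Y i j a : lrel (lres c Y) i j a -> lrel c i j a.
  rewrite lresE; case: ifP => // _ /andP[/eqP<- /negbTE->]; exact: lrel_refl.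
have inY Y i j a : proper_tr i j a -> lrel (lres c Y) i j a -> i \in Y /\ j \in Y.
  rewrite lresE; case: ifP => [/andP[]//|_] pr /andP[ij na].
  by move: pr; rewrite /proper_tr ij (negbTE na).
apply: dprod_gstab; try exact: sub.
- move=> i j a h1 h2; apply/negP => pr.
  have [iX _] := inY _ _ _ _ pr h1; have [] := inY _ _ _ _ pr h2.
  by rewrite inE iX.
- move=> i j a pr /setIP[_]; rewrite tr_stab !lresE !inE => cij.
  have [iX|iX] := boolP (i \in X); first by rewrite (clX _ _ _ iX cij) cij.
  have jX : j \notin X by apply: contra iX => jX; apply: clX jX _; rewrite lrel_sym; exact: cij.
  by rewrite (negbTE jX) /= cij orbT.
move=> i j k l a b pr pr' h1 h2; apply: tr_comm; left.
have [iX jX] := inY _ _ _ _ pr h1; have [] := inY _ _ _ _ pr' h2.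
rewrite !inE => kX lX.
by apply/and4P; split; [move: kX|move: kX|move: lX|move: lX]; apply: contraNneq => ->.
Qed.

(** Two nontrivial factors would each move a coordinate of [X]. As [X] is connected by relations,
    [moved_closed] makes both move the same one, against [moved_disjoint]. *)
Lemma irreducible_gstab c (X : {set 'I_n}) :
    (forall i j, i \in X -> j \in X -> exists a, lrel c i j a) ->
    no_D2_block G (lres c X) -> gstab G (lres c X) :!=: 1%g ->
  irreducible_reflection_subgroup rG (gstab G (lres c X)).
Proof.
move=> conn nice nt; rewrite /irreducible_reflection_subgroup gstab_reflections // nt !andTb; apply/existsPn => K; apply/existsPn => L; apply/negP.
case/and5P=> Kr Lr ntK ntL /eqP KxL.
have movedI (M : {group signed_perm n}) : reflection_subgroup rG M -> M :!=: 1%g ->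
    M \subset gstab G (lres c X) -> exists2 i, i \in X & i \in moved M.
  move=> Mr ntM Msub.
  have [i im|/= m0] := pickP (mem (moved M)); last first.
    case/negP: ntM; rewrite -subG1; apply/(reflection_subgroupP rGE _ Mr) => i j a pr tM.
    by have /movedP[] := negbT (m0 i); exists j, a.
  exists i => //; case/movedP: (im) => j [a [pr tM]].
  have /setIP[_] := subsetP Msub _ tM; rewrite tr_stab lresE.
  case: ifP => [/andP[]//|_] /andP[ij na].
  by move: pr; rewrite /proper_tr ij (negbTE na).
have [_ KL _ _] := dprodP KxL.
have [i iX iK] : exists2 i, i \in X & i \in moved K by apply: movedI; rewrite // -KL mulG_subl.
have [j jX jL] : exists2 i, i \in X & i \in moved L by apply: movedI; rewrite // -KL mulG_subr.
have [a cij] := conn i j iX jX.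
apply: (moved_disjoint GBD nice KxL _ jL).
by apply: (moved_closed GBD KxL (a := a) iK); rewrite lresE iX jX.
Qed.

(** Each block gives a direct factor that is trivial or irreducible, whose rank has to be even.
    Conversely [factor_gstab] shows that a component comes from a union of blocks, and such a union
    has even corank by [even_corank]. *)
Lemma even_gstabP c (cZ : G = WB n \/ #|zero_set c| != 1%N) :
  reflect (even_label c /\ (G = WB n \/ #|zero_set c| != 2%N))
    (gstab G c \in even_parabolics rG).
Proof.
rewrite inE; have -> /= : `[< parabolic rG (gstab G c) >] by apply/asboolP/gstab_parabolic.
have D1 X : closed_under c X -> G = WB n \/ #|zero_set (lres c X)| != 1%N.
  move=> clX; case: cZ => [|Z1]; [by left|right].
  by case: (zero_set_lres clX) => ->; rewrite ?cards0.
apply: (iffP forall_inP) => [evH|[ev cG] K].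
  have comp c1 c2 : irreducible_reflection_subgroup rG (gstab G c1) ->
      (gstab G c1 \x gstab G c2)%g = gstab G c ->
      ~~ odd (reflection_rank rG (gstab G c1)).
    move=> irr E; apply: evH; rewrite inE irr /=; apply/existsP.
    by exists (gstab G c2); rewrite gstab_reflections //= E.
  (* In type D a zero block {i, j} is D_2: [tr i j false] alone generates a direct factor, which is
     a component of odd rank 1. *)
  have nice : no_D2_block G c.
    have [GB|GD] := GBD; [by left|right]; apply/negP => /cards2P[i [j [ij Zij]]].
    have Z k : (c k == 0) = (k \in [set i; j]) by rewrite -Zij inE.
    pose c0 k : int := if k \in [set i; j] then 1 else 0.
    (* The labels 1 and -1 keep only [tr i j true] on {i, j}; doubling the other labels keeps them
       apart from these. *)
    pose c2 k : int := if k == i then 1 else if k == j then -1 else 2 * c k.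
    have c0i : c0 i = 1 by rewrite /c0 !inE eqxx.
    have c0j : c0 j = 1 by rewrite /c0 !inE eqxx orbT.
    have X0 : blk c0 i = [set i; j].
      by apply/setP=> k; rewrite [LHS]inE /lrel c0i /c0; case: (k \in _).
    pose c1 := lres c0 [set i; j].
    have Zc1 : zero_set c1 = set0.
      by apply/setP=> k; rewrite !inE lres_zero /c0; case: ifP.
    have rel1 k l a : proper_tr k l a -> lrel c1 k l a ->
        [/\ k \in [set i; j], l \in [set i; j], k != l & a = false].
      rewrite lresE; case: ifP => [/andP[kX lX] pr|_ pr /andP[kl na]]; last first.
        by move: pr; rewrite /proper_tr kl (negbTE na).
      by rewrite /lrel /c0 kX lX; move: pr; rewrite /proper_tr; case: (a); rewrite // orbF.
    have rel2 k l a : lrel c2 k l a ->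
        if k \in [set i; j] then (l \in [set i; j]) && (a == (k != l)) else lrel c k l a.
      rewrite /lrel /c2 !inE.
      have := Z k; have := Z l; rewrite !inE.
      have [->|ki] := eqVneq k i; have [->|li] := eqVneq l i => //=;
        rewrite ?eqxx ?(negbTE ij) ?[j == i]eq_sym ?(negbTE ij) /=;
        try (have [->|kj] := eqVneq k j); try (have [->|lj] := eqVneq l j);
        rewrite ?eqxx ?[i == j]eq_sym ?[j == i]eq_sym ?(negbTE ij) /=; case: (a) => //= Zl Zk; try lia.
    have E : (gstab G c1 \x gstab G c2)%g = gstab G c.
      have inZ k l a : lrel c k l a -> (k \in [set i; j]) = (l \in [set i; j]).
        by move/lrel_zero; rewrite !Z.
      have ZZ k l a : k \in [set i; j] -> l \in [set i; j] -> lrel c k l a.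
        by rewrite -!Z => /eqP ck cl; rewrite zero_lrelP.
      apply: dprod_gstab.
      - move=> k l a ckl; have [/rel1/(_ ckl)[kZ lZ _ _]|] := boolP (proper_tr k l a).
          exact: ZZ.
        by rewrite negb_or negbK => /andP[/eqP<- /negbTE->]; apply: lrel_refl.
      - by move=> k l a /rel2; case: ifP => // kZ /andP[lZ _]; apply: ZZ.
      - move=> k l a h1 h2; apply/negP => pr; have [kZ _ kl aF] := rel1 _ _ _ pr h1.
        by have := rel2 _ _ _ h2; rewrite kZ kl aF andbF.
      - move=> k l a pr /setIP[tG]; rewrite tr_stab => ckl.
        have kl : k != l.
          by move: pr tG; rewrite GD tr_WD /proper_tr; case: (k != l); case: (a).
        have := inZ _ _ _ ckl; have [kZ /esym lZ|kZ /esym lZ] := boolP (k \in [set i; j]).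
          rewrite lresE kZ lZ /lrel /c0 kZ lZ; case: (a); rewrite ?eqxx //.
          move: kZ lZ kl; rewrite /c2 !inE => /orP[]/eqP-> /orP[]/eqP->; rewrite ?eqxx //.
            by rewrite eq_sym => /negbTE->.
          by move=> /negbTE->.
        move: kZ lZ ckl; rewrite /lrel /c2 !inE => /norP[/negbTE-> /negbTE->] /norP[/negbTE-> /negbTE->].
        by case: (a) => /eqP ->; rewrite ?mulrN eqxx orbT.
      move=> k l k' l' a b pr pr' /(rel1 _ _ _ pr)[kZ lZ kl _] /rel2.
      case: ifP => [k'Z /andP[l'Z bE]|/negbT k'Z ckl'].
        have kl' : k' != l'.
          by move: pr' bE; rewrite /proper_tr; case: (k' != l'); case: (b).
        have [[-> ->]|[-> ->]] : (k' = k /\ l' = l) \/ (k' = l /\ l' = k).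
        - move: kZ lZ k'Z l'Z kl kl'; rewrite !inE.
          by do 4![case/orP=> /eqP->]; rewrite ?eqxx //; auto.
        - by apply: tr_comm; right.
        - by rewrite [tr l k b]tr_sym; apply: tr_comm; right.
      have l'Z : l' \notin [set i; j] by rewrite -(inZ _ _ _ ckl').
      apply: tr_comm; left.
      by apply/and4P; split; [move: k'Z|move: k'Z|move: l'Z|move: l'Z]; apply: contraNneq => ->.
    have irr : irreducible_reflection_subgroup rG (gstab G c1).
      apply: irreducible_gstab.
      - by move=> k l; rewrite /lrel /c0 => -> ->; exists false.
      - by right; rewrite -/c1 Zc1 cards0.
      - apply/negP => /eqP K1; have : tr i j false \in gstab G c1.
          by rewrite tr_gstab // lresE !inE !eqxx orbT /lrel c0i c0j.
        by rewrite K1 inE tr_eq1 /proper_tr ij.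
    have := comp _ _ irr E; rewrite rank_gstab //; last by right; rewrite Zc1 cards0.
    by have := corank_lres_blk c0 i; rewrite X0 -/c1 => ->; rewrite cards2 ij c0i.
  split; last exact: nice.
  apply/forallP=> i; have clX := @closed_blk n c i.
  have [nt|nt] := boolP (gstab G (lres c (blk c i)) :!=: 1%g).
    have := comp _ _ _ (dprod_lres clX).
    rewrite (rank_gstab rGE GBD (D1 _ clX)) corank_lres_blk => ev.
    have evX : ~~ odd (#|blk c i| - (c i != 0)).
      apply: ev; apply: irreducible_gstab => //.
        by move=> j k ij; rewrite -(blk_eq ij) => /blkP[a]; exists a.
      case: nice => [GB|Z2]; [by left|right].
      by case: (zero_set_lres clX) => ->; rewrite ?cards0.
    move: evX; rewrite oddB; last by case: (_ != _); rewrite // card_gt0; apply/set0Pn; exists i; apply: blk_refl.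
    by case: (_ != 0); case: odd.
  (* A trivial factor means a singleton block. Its label is nonzero, since otherwise type B has the
     sign change and in the other case [cZ] gives a second zero. *)
  have trivC j a : lrel c i j a -> i != j -> False.
    move=> cij ij; have : tr i j a \in gstab G (lres c (blk c i)).
      have jX : j \in blk c i by apply/blkP; exists a.
      by rewrite tr_gstab // lresE blk_refl jX.
    by move: nt; rewrite negbK => /eqP->; rewrite inE tr_eq1 /proper_tr ij.
  have -> : blk c i = [set i].
    apply/setP=> j; rewrite inE; apply/idP/eqP => [/blkP[a cij]|->]; last exact: blk_refl.
    by apply/esym/eqP; apply: contraT => /(trivC _ _ cij).
  rewrite cards1 eq_sym; apply/eqP/negP => /eqP ci.
  case: cZ => [GB|Z1].
    have : tr i i true \in gstab G (lres c (blk c i)).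
      by rewrite inE tr_stab lresE blk_refl lrel_int0 ci eqxx GB inE.
    by move: nt; rewrite negbK => /eqP->; rewrite inE tr_eq1 /proper_tr orbT.
  have [j] : exists2 j, c j = 0 & j != i.
    have : ~~ (zero_set c \subset [set i]).
      apply: contra Z1 => Zi; rewrite (_ : zero_set c = [set i]) ?cards1 //.
      by apply/eqP; rewrite eqEsubset Zi sub1set inE ci.
    by case/subsetPn=> j; rewrite !inE => /eqP; exists j.
  by move=> cj; rewrite eq_sym => ij; apply: (trivC j false _ ij); rewrite zero_lrelP // cj.
rewrite inE => /andP[irrK /existsP[L /andP[Lr /eqP KxL]]].
have Kr : reflection_subgroup rG K by case/and3P: irrK.
have clX : closed_under c (moved K) by move=> i j a; apply: (moved_closed GBD KxL).
rewrite (factor_gstab rGE GBD cG Kr Lr KxL) (rank_gstab rGE GBD (D1 _ clX)).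
exact/even_corank/even_lres.
Qed.

End Even.

(** * Moebius functions and restriction to fewer coordinates *)

Section MoebiusInversion.

Variables (T : finType) (le : rel T).
Hypothesis le_refl : reflexive le.
Hypothesis le_anti : antisymmetric le.
Hypothesis le_trans : transitive le.

(** Uniqueness in Moebius inversion, by induction on the number of elements below [y]. *)
Lemma sum_below_eq0 (P : {set T}) (V : zmodType) (d : T -> V) :
    (forall y, y \in P -> \sum_(z in P | le z y) d z = 0) ->
  {in P, forall y, d y = 0}.
Proof.
move=> d0 y; have [m] := ubnP #|[set z in P | le z y]|; elim: m y => // m IHm y ym yP.
have := d0 y yP; rewrite (bigD1 y) /=; last by rewrite yP le_refl.
rewrite big1 ?addr0 // => z /andP[/andP[zP zy] zNy]; apply: IHm => //.
rewrite ltnS in ym; apply: leq_trans ym; apply/proper_card/properP; split.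
  by apply/subsetP=> x; rewrite !inE => /andP[-> xz]; apply: le_trans zy.
exists y; rewrite !inE yP ?le_refl //=; apply: contra zNy => yz.
by apply/eqP/le_anti; rewrite zy yz.
Qed.

Lemma sum_moebius (P : {set T}) x : x \in P -> (forall z, z \in P -> le x z) ->
  {in P, forall y, \sum_(z in P | le z y) moebius le P x z = (y == x)%:R}.
Proof.
move=> xP min y yP; rewrite (bigD1 y) /=; last by rewrite yP le_refl.
rewrite (moebiusE le_anti le_trans) // min // [x == y]eq_sym.
case: eqVneq => [->|_].
  rewrite big1 ?addr0 // => z /andP[/andP[zP zx] /eqP[]]; apply: le_anti.
  by rewrite zx min.
apply/eqP; rewrite addrC subr_eq0; apply/eqP/eq_bigl => z.
by have [zP|] //= := boolP (z \in P); rewrite min.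
Qed.

End MoebiusInversion.

(** The Moebius function is the only one with these sums over lower sets. The candidate [f] is
    indexed by [P'] since type D elements arise as images of type B ones. *)
Lemma moebius_image (T T' : finType) (le : rel T) (P' : {set T'}) (phi : T' -> T)
    (f : T' -> int) x :
    reflexive le -> antisymmetric le -> transitive le ->
    {in P' &, injective phi} -> x \in phi @: P' ->
    (forall z, z \in P' -> le x (phi z)) ->
    {in P', forall y, \sum_(z in P' | le (phi z) (phi y)) f z = (phi y == x)%:R} ->
  {in P', forall y, moebius le (phi @: P') x (phi y) = f y}.
Proof.
move=> le_refl le_anti le_trans phi_inj xP min sum_f.
pose mu y := moebius le (phi @: P') x y.
have sum_mu : {in P', forall y,
    \sum_(z in P' | le (phi z) (phi y)) mu (phi z) = (phi y == x)%:R}.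
  move=> y yP; rewrite -(sum_moebius le_refl le_anti le_trans xP) ?imset_f //; last first.
    by move=> _ /imsetP[z zP ->]; apply: min.
  rewrite [RHS]big_mkcondr (big_imset _ phi_inj) /= -big_mkcondr.
  by apply: eq_bigl => z.
(* phi need not be injective off P', so sum_below_eq0 is used along phi @: P'. *)
pose d t := \sum_(y in P' | phi y == t) (mu (phi y) - f y).
have dE y : y \in P' -> d (phi y) = mu (phi y) - f y.
  move=> yP; rewrite /d (bigD1 y) /=; last by rewrite yP eqxx.
  rewrite big1 ?addr0 // => z /andP[/andP[zP /eqP zy]] /eqP[].
  exact: phi_inj zy.
have d0 : {in phi @: P', forall t, d t = 0}.
  apply: (sum_below_eq0 le_refl le_anti le_trans) => _ /imsetP[y yP ->].
  rewrite big_mkcondr (big_imset _ phi_inj) /= -big_mkcondr.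
  rewrite (eq_bigr (fun z => mu (phi z) - f z)) => [|z /andP[/dE]//].
  by rewrite sumrB sum_mu // sum_f // subrr.
by move=> y yP; apply/eqP; rewrite -subr_eq0 -dE ?d0 ?imset_f.
Qed.

(** * Reading labels off the groups in type B *)

Section LabelsB.

Variables (R : realType) (n : nat).
Implicit Types (i j k : 'I_n) (a b : bool) (c : 'I_n -> int) (S : {set 'I_n}).

Lemma reprBE w : reprB n R w = sp_mx R w. Proof. by []. Qed.
Lemma reprDE w : reprD n R w = sp_mx R w. Proof. by []. Qed.
Lemma WB_cases : WB n = WB n \/ WB n = WD n. Proof. by left. Qed.
Lemma WD_cases : WD n = WB n \/ WD n = WD n. Proof. by right. Qed.

Lemma gstabB_sub c c' :
  reflect (forall i j a, lrel c i j a -> lrel c' i j a)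
    (gstab (WB n) c \subset gstab (WB n) c').
Proof.
apply: (iffP idP) => [sub i j a cij|h]; last exact/setIS/stab_sub.
have : tr i j a \in gstab (WB n) c by rewrite inE tr_stab cij inE.
by move/(subsetP sub); rewrite inE tr_stab => /andP[].
Qed.

Lemma gstabB_inj c c' : gstab (WB n) c = gstab (WB n) c' ->
  forall i j a, lrel c i j a = lrel c' i j a.
Proof.
by move=> E i j a; apply/idP/idP; move: i j a; apply/gstabB_sub; rewrite E.
Qed.

(** Recovers the zero block from the group: the sign change of e_i preserves [c] exactly when c i =
    0. *)
Definition zeros (H : {group signed_perm n}) := [set i | tr i i true \in H].

Lemma zeros_gstab c : zeros (gstab (WB n) c) = zero_set c.
Proof. by apply/setP=> i; rewrite !inE -lrel_int0 -tr_stab inE. Qed.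

Definition even_B := even_parabolics (reprB n R).

Lemma gstab_even_B c : even_label c -> gstab (WB n) c \in even_B.
Proof. by move=> ev; apply/(even_gstabP reprBE WB_cases); [left|split; [|left]]. Qed.

Lemma even_B_label H : H \in even_B -> exists2 c, H = gstab (WB n) c & even_label c.
Proof.
move=> HE; have : parabolic (reprB n R) H by move: HE; rewrite inE => /andP[/asboolP].
case/(parabolic_label reprBE) => c Hc; exists c => //; move: HE; rewrite Hc.
by case/(even_gstabP reprBE WB_cases); first left.
Qed.

Lemma rank_gstabB c : reflection_rank (reprB n R) (gstab (WB n) c) = (n - #|blocks c|)%N.
Proof. by apply: rank_gstab => //; left. Qed.

Lemma lres0_gstab c S :
  (gstab (WB n) (lres (fun=> 0) S) \subset gstab (WB n) c) = (S \subset zero_set c).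
Proof.
apply/gstabB_sub/subsetP => [h i iS|SZ i j a].
  by rewrite inE -lrel_int0; apply: h; rewrite lresE iS lrel_int0.
rewrite lresE; case: ifP => [/andP[/SZ + /SZ]|_ /andP[/eqP-> /negbTE->]].
  by rewrite !inE => /eqP ci cj _; rewrite zero_lrelP.
exact: lrel_refl.
Qed.

Lemma gstab_lres0 c : gstab (WB n) (lres c set0) = 1%G.
Proof.
apply/group_inj/trivgP/(gstab_subP reprBE WB_cases) => i j a pr; rewrite inE tr_stab lresE in_set0 /=.
by case/andP=> _ /andP[/eqP ij na]; move: pr; rewrite /proper_tr ij eqxx (negbTE na).
Qed.

Lemma even_lres0 c : even_label (lres c set0).
Proof.
apply/forallP=> i; rewrite lres_zero inE blk_lres ?inE ?cards1 //.
by move=> ? ? ?; rewrite inE.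
Qed.

Lemma one_even_B : 1%G \in even_B.
Proof. by rewrite -(gstab_lres0 (fun=> 0)); apply: gstab_even_B; apply: even_lres0. Qed.

Lemma group_le_anti (gT : finGroupType) :
  antisymmetric (fun H K : {group gT} => H \subset K).
Proof. by move=> H K HK; apply/val_inj/eqP; rewrite eqEsubset. Qed.

Lemma group_le_trans (gT : finGroupType) :
  transitive (fun H K : {group gT} => H \subset K).
Proof. by move=> K H L; apply: subset_trans. Qed.

Lemma group_le_refl (gT : finGroupType) :
  reflexive (fun H K : {group gT} => H \subset K).
Proof. by move=> H; apply: subxx. Qed.

Lemma sum_moebius_even_B : {in even_B, forall H : {group signed_perm n},
  \sum_(K in even_B | K \subset H) moebius_even (reprB n R) 1%G K = (H == 1%G)%:R}.
Proof.
apply: (sum_moebius (@group_le_refl _) (@group_le_anti _) (@group_le_trans _)).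
  exact: one_even_B.
by move=> K _; apply: sub1G.
Qed.

(** A chosen labelling, determined only up to [lrel]; the zero labelling is a default for groups
    that are not stabilizers. *)
Definition label (H : {group signed_perm n}) : 'I_n -> int :=
  if pselect (exists c, H = gstab (WB n) c) is left e then sval (cid e) else fun=> 0.

Lemma labelP c i j a : lrel (label (gstab (WB n) c)) i j a = lrel c i j a.
Proof.
rewrite /label; case: pselect => [e|[]]; last by exists c.
by case: cid => c' /= /gstabB_inj->.
Qed.

End LabelsB.

(** * The elements above z_S and type B in rank n - 2 *)

Section Restriction.

Variables (R : realType) (m n : nat) (h : 'I_m -> 'I_n).
Hypothesis h_inj : injective h.
Hypothesis mn : n = m.+2.
Implicit Types (i j : 'I_n) (k l : 'I_m) (a b : bool) (c : 'I_n -> int).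

Let S := ~: (h @: [set: 'I_m]).

Let card_S : #|S| = 2%N.
Proof.
have := cardsC (h @: [set: 'I_m]); rewrite card_imset // cardsT !card_ord -/S; lia.
Qed.

Let hS k : h k \notin S. Proof. by rewrite inE negbK imset_f. Qed.
Let S_h i : i \notin S -> exists k, i = h k.
Proof. by rewrite inE negbK => /imsetP[k _ ->]; exists k. Qed.

Let lrel_h c k l a : lrel (c \o h) k l a = lrel c (h k) (h l) a.
Proof. by []. Qed.

(** Deletes the two coordinates outside the image of [h]; on stabilizers above z_S they are labelled
    0. *)
Definition restrict (H : {group signed_perm n}) := gstab (WB m) (label H \o h).

Let restrictE c : restrict (gstab (WB n) c) = gstab (WB m) (c \o h).
Proof.
by apply/val_inj; congr (_ :&: _); congr gval; apply: stab_eq => k l a; rewrite !lrel_h labelP.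
Qed.

Let zS := gstab (WB n) (lres (fun=> 0) S).

Let lrel_S c i j a : S \subset zero_set c -> i \in S -> lrel c i j a = (c j == 0).
Proof. by move=> SZ /(subsetP SZ); rewrite inE => /eqP/zero_lrelP. Qed.

(** A relation involving a coordinate of [S] only says that the other label is 0, and zeros are
    visible after restriction as relations of a coordinate with its own opposite. *)
Let restrict_sub c c' : S \subset zero_set c -> S \subset zero_set c' ->
  (gstab (WB m) (c \o h) \subset gstab (WB m) (c' \o h)) =
  (gstab (WB n) c \subset gstab (WB n) c').
Proof.
move=> Sc Sc'; apply/gstabB_sub/gstabB_sub => sub => [i j a|k l a]; last first.
  by rewrite !lrel_h; apply: sub.
have z i' : c i' == 0 -> c' i' == 0.
  have [/(subsetP Sc')|/S_h[k ->]] := boolP (i' \in S); first by rewrite inE.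
  by rewrite -!lrel_int0; apply: (sub k k true).
have [iS|/S_h[k ->]] := boolP (i \in S); first by rewrite !lrel_S //; apply: z.
have [jS|/S_h[l ->]] := boolP (j \in S); last exact: sub.
by rewrite [lrel c _ _ _]lrel_sym [lrel c' _ _ _]lrel_sym !lrel_S //; apply: z.
Qed.

Let card_blk_h c k : S \subset zero_set c ->
  #|blk c (h k)| = (#|blk (c \o h) k| + (c (h k) == 0%R) * 2)%N.
Proof.
move=> SZ; have -> : blk c (h k) = h @: blk (c \o h) k :|: (if c (h k) == 0 then S else set0).
  apply/setP=> j; rewrite in_setU; apply/blkP/orP => [[a cj]|].
    have [jS|/S_h[l E]] := boolP (j \in S).
      by right; rewrite lrel_sym lrel_S // in cj; rewrite cj.
    by left; rewrite E in cj *; apply: imset_f; apply/blkP; exists a.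
  case=> [/imsetP[l /blkP[a kl] ->]|]; first by exists a.
  case: ifP => [ck jS|]; last by rewrite inE.
  by exists false; rewrite lrel_sym lrel_S.
rewrite cardsU (_ : _ :&: _ = set0) ?cards0 ?subn0 ?card_imset //.
  by case: eqP => _; rewrite ?cards0 ?card_S.
apply/setP=> j; rewrite !inE; apply/negP => /andP[/imsetP[l _ ->]].
by case: ifP; rewrite ?(negbTE (hS l)) ?inE.
Qed.

Let corank_h c : S \subset zero_set c ->
  (n - #|blocks c| = (m - #|blocks (c \o h)|) + 2)%N.
Proof.
move=> SZ; apply/eqP; rewrite -(eqr_nat rat) natrD !corank_blocks; apply/eqP.
rewrite (bigID (mem S)) /= addrC; congr (_ + _); last first.
  rewrite -card_S -sum1_card natr_sum; apply: eq_bigr => i /(subsetP SZ).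
  by rewrite inE => ->.
rewrite (eq_bigl (mem (h @: [set: 'I_m]))) => [|i]; last by rewrite /= inE negbK.
rewrite big_imset /=; last by move=> k l _ _ /h_inj.
rewrite big_set /=; apply: eq_bigr => k _; rewrite card_blk_h //.
by case: eqP => //; rewrite mul0n addn0.
Qed.

Let even_h c : S \subset zero_set c -> even_label c = even_label (c \o h).
Proof.
move=> SZ; have oddE k : odd #|blk c (h k)| = odd #|blk (c \o h) k|.
  by rewrite card_blk_h // oddD oddM andbF addbF.
apply/idP/idP => /forallP ev; apply/forallP=> i; first by rewrite -oddE ev.
have [iS|/S_h[k ->]] := boolP (i \in S); last by rewrite oddE ev.
have := subsetP SZ _ iS; rewrite inE => /eqP ci; rewrite ci eqxx blk_zero //.
(* Either the zero block is [S], of size 2, or it contains some [h k], whose block parity is already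
   known. *)
have [E|[j jZ]] := set_0Vmem (zero_set c :\: S).
  rewrite (_ : zero_set c = S) ?card_S //.
  by apply/eqP; rewrite eqEsubset SZ andbT -setD_eq0 E.
move: jZ; rewrite in_setD => /andP[/S_h[k E]]; rewrite inE => /eqP cj.
by rewrite -(blk_zero cj) E oddE (eqP (ev k)) /= -E cj.
Qed.

Let extend (c' : 'I_m -> int) i := if [pick k | h k == i] is Some k then c' k else 0.

Let extendK (c' : 'I_m -> int) : extend c' \o h =1 c'.
Proof.
move=> k; rewrite /extend /=; case: pickP => [l /eqP/h_inj->//|/(_ k)].
by rewrite eqxx.
Qed.

Let extend_S (c' : 'I_m -> int) : S \subset zero_set (extend c').
Proof.
apply/subsetP=> i iS; rewrite inE /extend; case: pickP => // k /eqP E.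
by move: iS; rewrite -E (negbTE (hS k)).
Qed.

Let evS := [set H in even_B R n | zS \subset H].

Let evS_label H : H \in evS ->
  exists c, [/\ H = gstab (WB n) c, even_label c & S \subset zero_set c].
Proof.
rewrite inE => /andP[/even_B_label[c -> ev]]; rewrite lres0_gstab => SZ.
by exists c.
Qed.

Let restrict_inj : {in evS &, injective restrict}.
Proof.
move=> _ _ /evS_label[c [-> _ Sc]] /evS_label[c' [-> _ Sc']]; rewrite !restrictE => E.
by apply/val_inj/eqP; rewrite eqEsubset -!restrict_sub // E subxx.
Qed.

Let restrict_evS : even_B R m = restrict @: evS.
Proof.
apply/setP=> K; apply/idP/imsetP => [/even_B_label[c' -> ev]|[_ /evS_label[c [-> ev Sc]] ->]].
  have E : gstab (WB m) c' = gstab (WB m) (extend c' \o h).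
    by apply/val_inj; congr (_ :&: _); congr gval; apply: stab_eq => k l a; rewrite /lrel !extendK.
  have evE : even_label (extend c' \o h).
    apply/forallP=> k; rewrite extendK.
    rewrite (_ : blk _ k = blk c' k) ?(forallP ev) //.
    by apply/setP=> l; rewrite !inE /lrel !extendK.
  exists (gstab (WB n) (extend c')); last by rewrite restrictE.
  by rewrite inE gstab_even_B ?even_h // lres0_gstab extend_S.
by rewrite restrictE; apply: gstab_even_B; rewrite -even_h.
Qed.

Let restrict1 H : H \in evS -> (restrict H == 1%G) = (H == zS).
Proof.
move=> HS; have zSS : zS \in evS.
  rewrite inE subxx andbT; apply: gstab_even_B; rewrite even_h; last first.
    by apply/subsetP=> i iS; rewrite inE lres_zero iS /=.
  have -> : even_label (lres (fun=> 0) S \o h) = even_label (lres (fun=> 0 : int) (set0 : {set 'I_m})).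
    rewrite /even_label; apply: eq_forallb => k.
    have -> : blk (lres (fun=> 0) S \o h) k = blk (lres (fun=> 0 : int) (set0 : {set 'I_m})) k.
      apply/setP=> l; rewrite !inE !lrel_h !lresE !inE /= -!in_setC.
      by rewrite !(negbTE (hS _)) /= (inj_eq h_inj).
    by rewrite /= !lres_zero (negbTE (hS k)) inE.
  exact: even_lres0.
have <- : restrict zS = 1%G.
  apply/group_inj/trivgP; rewrite restrictE.
  apply/(gstab_subP (@reprBE R m) (@WB_cases m)) => k l a pr.
  rewrite inE tr_stab lrel_h lresE (negbTE (hS _)) /= => /and3P[_ /eqP/h_inj kl na].
  by move: pr; rewrite /proper_tr kl eqxx (negbTE na).
by apply/eqP/eqP => [/restrict_inj->|->].
Qed.

(** This is mu_B(z_S, H), extended by 0 to elements not above z_S. *)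
Definition shifted_moebius (H : {group signed_perm n}) : int :=
  if zS \subset H then moebius_even (reprB m R) 1%G (restrict H) else 0.

Lemma sum_shifted_moebius : {in even_B R n, forall H : {group signed_perm n},
  \sum_(K in even_B R n | K \subset H) shifted_moebius K = (H == zS)%:R}.
Proof.
move=> H HB; rewrite /shifted_moebius.
have [zH|zH] := boolP (zS \subset H); last first.
  rewrite (_ : H == zS = false); last by apply: contraNF zH => /eqP->.
  rewrite big1 // => K /andP[_ KH]; case: ifP => // zK.
  by rewrite (subset_trans zK KH) in zH.
have HS : H \in evS by rewrite inE HB.
rewrite -restrict1 // -(sum_moebius_even_B (R := R)); last by rewrite restrict_evS imset_f.
rewrite -big_mkcondr restrict_evS [RHS]big_mkcondr (big_imset _ restrict_inj) -big_mkcondr.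
apply: eq_bigl => K; rewrite [K \in evS]inE -!andbA; apply: andb_id2l => KB.
rewrite andbC; apply: andb_id2l => zK; have KS : K \in evS by rewrite inE KB.
have [c [-> _ Sc]] := evS_label KS; have [c' [-> _ Sc']] := evS_label HS.
by rewrite !restrictE restrict_sub.
Qed.

Lemma shifted_char_poly :
  \sum_(H in even_B R n) shifted_moebius H *: 'X^((reflection_rank (reprB n R) H)./2) =
    'X * even_char_poly (reprB m R).
Proof.
rewrite /even_char_poly -/(even_B R m) restrict_evS (big_imset _ restrict_inj) /=.
rewrite mulr_sumr [RHS](eq_bigl (fun H => (H \in even_B R n) && (zS \subset H))); last first.
  by move=> H; rewrite inE.
rewrite [RHS]big_mkcondr; apply: eq_bigr => H HB; rewrite /shifted_moebius.
case: ifP => [zH|]; last by rewrite scale0r.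
have HS : H \in evS by rewrite inE HB.
have [c [-> _ Sc]] := evS_label HS; rewrite restrictE !rank_gstabB corank_h //.
by rewrite addn2 /= exprS scalerAr.
Qed.

End Restriction.

(** * From type B to type D *)

Section EvenSubgroup.

Variables (R : realType) (n : nat).
Implicit Types (i j k : 'I_n) (a b : bool) (c : 'I_n -> int) (S : {set 'I_n}).
Implicit Types (H K : {group signed_perm n}).

Definition even_part H : {group signed_perm n} := (WD n :&: H)%G.

Lemma even_part_gstab c : even_part (gstab (WB n) c) = gstab (WD n) c.
Proof. by apply/group_inj/setP=> w; rewrite !inE. Qed.

(** Only sign changes are missing from W(D_n). A zero [i] of [c] has a companion zero [k], and
    carrying both signs of their relation over to [c'] forces c' i = 0. *)
Lemma gstabD_sub c c' : #|zero_set c| != 1%N ->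
  (gstab (WD n) c \subset gstab (WD n) c') = (gstab (WB n) c \subset gstab (WB n) c').
Proof.
move=> Z1; apply/idP/gstabB_sub => [sub|]; last by move/stab_sub/setIS; apply.
have sub_off i j a : i != j -> lrel c i j a -> lrel c' i j a.
  move=> ij cij; have : tr i j a \in gstab (WD n) c by rewrite tr_gstab //; right.
  by move/(subsetP sub); rewrite tr_gstab //; right.
move=> i j a cij; have [ij|] := eqVneq i j; last by move/sub_off; apply.
move: cij; rewrite -ij; case: a => [|_]; last exact: lrel_refl.
rewrite !lrel_int0 => ci.
have : ~~ (zero_set c \subset [set i]).
  apply: contra Z1 => Zi; rewrite (_ : zero_set c = [set i]) ?cards1 //.
  by apply/eqP; rewrite eqEsubset Zi sub1set inE ci.
case/subsetPn=> k; rewrite !inE => ck ki; have ik : i != k by rewrite eq_sym.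
have Ef : lrel c' i k false by apply: sub_off => //; rewrite zero_lrelP //; apply/eqP.
have Et : lrel c' i k true by apply: sub_off => //; rewrite zero_lrelP //; apply/eqP.
by have [|->] := zero_lrel _ Ef Et.
Qed.

Definition even_B_not2 := [set H in even_B R n | #|zeros H| != 2%N].

Lemma even_B_not2_label H : H \in even_B_not2 ->
  exists c, [/\ H = gstab (WB n) c, even_label c, #|zero_set c| != 2%N & #|zero_set c| != 1%N].
Proof.
rewrite inE => /andP[/even_B_label[c -> ev]]; rewrite zeros_gstab => Z2; exists c; split=> //.
by have := even_zero_set ev; apply: contra => /eqP->.
Qed.

Lemma even_part_sub : {in even_B_not2 &, forall H K,
  (even_part H \subset even_part K) = (H \subset K)}.
Proof.
move=> _ _ /even_B_not2_label[c [-> _ _ Z1]] /even_B_not2_label[c' [-> _ _ _]].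
by rewrite !even_part_gstab gstabD_sub.
Qed.

Lemma even_part_inj : {in even_B_not2 &, injective even_part}.
Proof.
move=> H K HB KB E; apply/val_inj/eqP.
by rewrite eqEsubset -(even_part_sub HB KB) -(even_part_sub KB HB) E subxx.
Qed.

Lemma even_D_image : even_parabolics (reprD n R) = even_part @: even_B_not2.
Proof.
have evDP c : #|zero_set c| != 1%N -> (gstab (WD n) c \in even_parabolics (reprD n R)) =
    even_label c && (#|zero_set c| != 2%N).
  move=> Z1; have cZ : WD n = WB n \/ #|zero_set c| != 1%N by right.
  apply/(even_gstabP (@reprDE R n) (@WD_cases n) cZ)/andP => [[ev Z2]|[ev Z2]]; last first.
    by split=> //; right.
  split=> //; case: Z2 => // E; apply/negP => /cards2P[i _].
  by have := tr_WD i i true; rewrite E inE eqxx.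
apply/setP=> K; apply/idP/imsetP => [KD|[_ /even_B_not2_label[c [-> ev Z2 Z1]] ->]]; last first.
  by rewrite even_part_gstab evDP // ev.
have : parabolic (reprD n R) K by move: KD; rewrite inE => /andP[/asboolP].
case/(parabolic_label (@reprDE R n)) => c0 Kc0.
have [c Kc Z1] : exists2 c, K = gstab (WD n) c & #|zero_set c| != 1%N.
  (* A lone zero coordinate gets a nonzero label of its own; the stabilizer is unchanged because
     W(D_n) contains no single sign change. *)
  have [/eqP/cards1P[z Zz]|Z1] := eqVneq #|zero_set c0| 1%N; last by exists c0.
  exists (lres c0 (~: zero_set c0)); last first.
    rewrite (_ : zero_set _ = set0) ?cards0 //.
    by apply/setP=> i; rewrite !inE lres_zero !inE andNb.
  rewrite Kc0; apply/group_inj/eqP; rewrite eqEsubset; apply/andP; split; last first.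
    apply/setIS/stab_sub => i j a; rewrite lresE.
    by case: ifP => // _ /andP[/eqP<- /negbTE->]; apply: lrel_refl.
  apply/(gstab_subP (@reprDE R n) (@WD_cases n)) => i j a pr /setIP[tD].
  rewrite in_setI tD andTb !tr_stab lresE => cij; rewrite !inE (lrel_zero cij) andbb.
  have [cj|//] := eqVneq (c0 j) 0; have ci : c0 i = 0 by apply/eqP; rewrite (lrel_zero cij) cj.
  have iz : i \in [set z] by rewrite -Zz inE ci eqxx.
  have jz : j \in [set z] by rewrite -Zz inE cj eqxx.
  move: tD pr; rewrite (set1P iz) (set1P jz).
  by rewrite tr_WD /proper_tr eqxx /= => /negbTE->.
move: KD; rewrite Kc evDP // => /andP[ev Z2].
exists (gstab (WB n) c); last by rewrite even_part_gstab.
by rewrite inE gstab_even_B // zeros_gstab.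
Qed.

Lemma reflection_rank_even_part : {in even_B_not2, forall H,
  reflection_rank (reprD n R) (even_part H) = reflection_rank (reprB n R) H}.
Proof.
move=> _ /even_B_not2_label[c [-> _ _ Z1]].
rewrite even_part_gstab rank_gstabB (rank_gstab (@reprDE R n) (@WD_cases n)) //.
by right.
Qed.

End EvenSubgroup.

(** An enumeration of the complement of [S] serves as [h]; only three properties of the resulting
    function are kept. *)
Lemma shifted_exists (R : realType) (n : nat) (S : {set 'I_n}) : #|S| = 2%N ->
  exists g : {group signed_perm n} -> int,
  [/\ {in even_B R n, forall H : {group signed_perm n}, \sum_(K in even_B R n | K \subset H) g K =
        (H == gstab (WB n) (lres (fun=> 0) S))%:R},
      forall H : {group signed_perm n}, ~~ (gstab (WB n) (lres (fun=> 0) S) \subset H) -> g H = 0 &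
      \sum_(H in even_B R n) g H *: 'X^((reflection_rank (reprB n R) H)./2) =
        'X * even_char_poly (reprB (n - 2) R)].
Proof.
move=> S2; have n2 : (2 <= n)%N by rewrite -S2 -[n in (_ <= n)%N]card_ord max_card.
have cS : #|~: S| = (n - 2)%N.
  by have := cardsC S; rewrite card_ord S2; lia.
pose h (k : 'I_(n - 2)) : 'I_n := enum_val (cast_ord (esym cS) k).
have h_inj : injective h by move=> k l /enum_val_inj/cast_ord_inj.
have mn : n = (n - 2).+2 by lia.
have SE : S = ~: (h @: [set: 'I_(n - 2)]).
  apply/esym; rewrite -[RHS]setCK; congr (~: _); apply/eqP.
  rewrite eqEcard card_imset // cardsT card_ord cS leqnn andbT.
  by apply/subsetP=> _ /imsetP[k _ ->]; apply: enum_valP.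
exists (shifted_moebius R h); rewrite SE; split.
- exact: sum_shifted_moebius.
- by move=> H; rewrite /shifted_moebius => /negbTE->.
- exact: shifted_char_poly.
Qed.

(** * The Moebius function of type D *)

Section Main.

Variables (R : realType) (n : nat).
Implicit Types (i j k : 'I_n) (c : 'I_n -> int) (S : {set 'I_n}).
Implicit Types (H K : {group signed_perm n}).

Let mu H := moebius_even (reprB n R) 1%G H.
Let zS S := gstab (WB n) (lres (fun=> 0) S).

Variable g : {set 'I_n} -> {group signed_perm n} -> int.
Hypothesis g_sum : forall S, #|S| = 2%N -> {in even_B R n, forall H,
  \sum_(K in even_B R n | K \subset H) g S K = (H == zS S)%:R}.
Hypothesis g0 : forall S H, #|S| = 2%N -> ~~ (zS S \subset H) -> g S H = 0.

Definition correction H := mu H + \sum_(S : {set 'I_n} | #|S| == 2%N) g S H.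

Lemma sum_correction : {in even_B R n, forall H,
  \sum_(K in even_B R n | K \subset H) correction K =
    (H == 1%G)%:R + \sum_(S : {set 'I_n} | #|S| == 2%N) (H == zS S)%:R}.
Proof.
move=> H HB; rewrite big_split /= sum_moebius_even_B //; congr (_ + _).
by rewrite exchange_big /=; apply: eq_bigr => S /eqP S2; apply: g_sum.
Qed.

Lemma correction_zeros_set0 c : zero_set c = set0 ->
  correction (gstab (WB n) c) = mu (gstab (WB n) c).
Proof.
move=> Z0; rewrite /correction big1 ?addr0 // => S /eqP S2; apply: g0 => //.
by rewrite lres0_gstab Z0 subset0 -cards_eq0 S2.
Qed.

(* Splitting the zero block {i, j} into two singletons gives the largest      *)
(* element below H with empty zero block, so the elements below H with empty  *)
(* zero block contribute the total Moebius mass of an interval.               *)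
Lemma correction_eq0 : {in even_B R n, forall H, #|zeros H| = 2%N -> correction H = 0}.
Proof.
move=> H; have [m] := ubnP #|H|; elim: m H => // m IHm H Hm HB Z2.
have := sum_correction HB; have [c Hc ev] := even_B_label HB.
have zH : zeros H = zero_set c by rewrite Hc zeros_gstab.
set S := zero_set c in zH; have S2 : #|S| = 2%N by rewrite -zH.
have clS : closed_under c (~: S).
  by move=> i j a; rewrite !inE => ci /lrel_zero <-.
pose c1 := lres c (~: S); pose H1 := gstab (WB n) c1.
have Z1 : zero_set c1 = set0.
  by apply/setP=> i; rewrite !inE lres_zero !inE andNb.
have H1B : H1 \in even_B R n by apply/gstab_even_B/even_lres.
have H1H : H1 \subset H.
  rewrite Hc; apply/gstabB_sub => i j a; rewrite lresE.
  by case: ifP => // _ /andP[/eqP<- /negbTE->]; apply: lrel_refl.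
have zHS S' : #|S'| = 2%N -> zS S' \subset H -> S' = S.
  rewrite Hc lres0_gstab => S'2 S'S; apply/eqP; rewrite eqEcard S'S.
  by rewrite -/S S2 S'2.
rewrite (_ : H == 1%G = false); last first.
  apply/eqP => H0; have : zeros H = set0; last by move=> E; rewrite E cards0 in Z2.
  by apply/setP=> i; rewrite !inE H0 inE tr_eq1 /proper_tr orbT.
rewrite add0r.
have -> : \sum_(S' : {set 'I_n} | #|S'| == 2%N) (H == zS S')%:R = (H == zS S)%:R :> int.
  rewrite (bigD1 S) /=; last by rewrite S2.
  rewrite big1 ?addr0 // => S' /andP[/eqP S'2 /eqP nS].
  have [E|] := eqVneq H (zS S') => //.
  by case: nS; apply: zHS => //; rewrite E.
rewrite (bigD1 H) /=; last by rewrite HB subxx.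
(* An even [K] strictly below [H] but not below [H1] has a nonempty zero block of even size inside
   [S], so of size 2, and its term vanishes by induction. *)
rewrite (bigID (fun K : {group _} => K \subset H1)) /= [X in _ + (_ + X)]big1 ?addr0; last first.
  move=> K /andP[/andP[/andP[KB KH] KNH] KNH1].
  have KpH : K \proper H.
    by rewrite properEneq KH andbT; apply: contraNneq KNH => /group_inj->.
  apply: IHm => //; first by rewrite (leq_trans (proper_card KpH)).
  have [d Kd evd] := even_B_label KB; rewrite Kd zeros_gstab.
  have dc : forall i j a, lrel d i j a -> lrel c i j a by apply/gstabB_sub; rewrite -Kd -Hc.
  have dS : zero_set d \subset S.
    by apply/subsetP=> i; rewrite !inE -!lrel_int0; apply: dc.
  have dN0 : zero_set d != set0.
    apply: contra KNH1 => /eqP d0; rewrite Kd; apply/gstabB_sub => i j a dij.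
    have cij := dc _ _ _ dij; rewrite lresE.
    have [iS|iS] := boolP (i \in ~: S); first by rewrite (clS _ _ _ iS cij).
    (* a block of d meeting S lies in S and has odd size, hence is a singleton *)
    rewrite /=; have blkS : blk d i \subset S.
      apply/subsetP=> k /blkP[b /dc cik]; move: iS; rewrite in_setC negbK !inE.
      by rewrite (lrel_zero cik).
    have di : d i != 0 by have := in_set0 i; rewrite -d0 inE => ->.
    have b1 : #|blk d i| = 1%N.
      have := subset_leq_card blkS; rewrite S2.
      have := forallP evd i; rewrite di => /eqP.
      by case: #|_| => [|[|[|]]].
    have /eqP := b1 => /cards1P[z bz].
    have iz : i = z by apply/set1P; rewrite -bz blk_refl.
    have jz : j = z by apply/set1P; rewrite -bz; apply/blkP; exists a.
    rewrite iz jz eqxx /=; move: dij; rewrite -jz in iz; rewrite -iz.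
    by case: a {cij} => //; rewrite lrel_int0 (negbTE di).
  have := subset_leq_card dS; rewrite S2; move: dN0; rewrite -card_gt0.
  by have := even_zero_set evd; case: #|_| => [|[|[|]]].
rewrite (eq_bigl (fun K : {group signed_perm n} => (K \in even_B R n) && (K \subset H1))); last first.
  move=> K; have [KH1|] := boolP (K \subset H1); last by rewrite !andbF.
  rewrite (subset_trans KH1 H1H) !andbT; case: (boolP (K \in _)) => //= KB.
  apply: contraTneq KH1 => ->; apply/negP => HH1.
  have : zeros H \subset zeros H1.
    by apply/subsetP=> i; rewrite !inE => tH; have := subsetP HH1 _ tH; rewrite !inE.
  by rewrite zeros_gstab Z1 subset0 -cards_eq0 Z2.
rewrite (eq_bigr mu); last first.
  move=> K /andP[KB KH1]; have [d Kd evd] := even_B_label KB; rewrite Kd.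
  apply: correction_zeros_set0; apply/eqP; rewrite -subset0 -Z1.
  move: KH1; rewrite Kd => /gstabB_sub dc1.
  by apply/subsetP=> i; rewrite !inE -!lrel_int0; apply: dc1.
rewrite sum_moebius_even_B // => E.
(* What remains is correction H + [H1 = 1] = [H = z_S]. The brackets agree: each says that [H] has
   no nontrivial relation off [S]. *)
suff EH : (H == zS S) = (H1 == 1%G).
  by apply: (addIr (H1 == 1%G)%:R); rewrite add0r E EH.
apply/eqP/eqP => [HS|H10].
  apply/group_inj/trivgP/(gstab_subP (@reprBE R n) (@WB_cases n)) => i j a pr /setIP[_].
  rewrite tr_stab lresE; case: ifP => [/andP[iS jS] cij|_ /andP[ij na]]; last first.
    by move: pr; rewrite /proper_tr ij (negbTE na).
  have : tr i j a \in H by rewrite Hc inE tr_stab cij inE.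
  rewrite HS => /setIP[_]; rewrite tr_stab lresE.
  move: iS; rewrite in_setC => /negbTE-> /= /andP[ij na].
  by move: pr; rewrite /proper_tr ij (negbTE na).
apply/group_inj/eqP; rewrite eqEsubset; apply/andP; split; last by rewrite Hc lres0_gstab.
rewrite Hc; apply/gstabB_sub => i j a cij; rewrite lresE.
have [iS|iS] := boolP (i \in S).
  by rewrite inE -(lrel_zero cij) -(in_set (fun i => c i == 0)) iS zero_lrelP.
have iS' : i \in ~: S by rewrite in_setC.
have : tr i j a \in H1.
  by rewrite /H1 in_setI tr_stab lresE iS' (clS _ _ _ iS' cij) cij inE.
by rewrite H10 inE tr_eq1 negb_or negbK => /andP[-> ->].
Qed.

(** Dropping elements with zero block of size 2 does not change the sums, by [correction_eq0], and
    no remaining element equals a z_S. So the sums are those of the Moebius function. *)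
Lemma moebius_evenD : {in even_B_not2 R n, forall H,
  moebius_even (reprD n R) 1%G (even_part H) = correction H}.
Proof.
rewrite /moebius_even even_D_image; have one2 : 1%G \in even_B_not2 R n.
  rewrite inE one_even_B (_ : zeros _ = set0) ?cards0 //.
  by apply/setP=> i; rewrite !inE tr_eq1 /proper_tr orbT.
have one_even : even_part (1%G : {group signed_perm n}) = 1%G.
  exact/group_inj/setIidPr/sub1G.
apply: moebius_image.
- exact: group_le_refl.
- exact: group_le_anti.
- exact: group_le_trans.
- exact: even_part_inj.
- by rewrite -one_even imset_f.
- by move=> K _; apply: sub1G.
move=> H HB2; have HB : H \in even_B R n by move: HB2; rewrite inE => /andP[].
rewrite -{1}one_even (inj_in_eq (@even_part_inj R n)) //.
transitivity (\sum_(K in even_B R n | K \subset H) correction K).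
  rewrite [RHS](bigID (fun K => #|zeros K| == 2%N)) /= [X in X + _]big1 ?add0r; last first.
    by move=> K /andP[/andP[KB _] /eqP]; apply: correction_eq0.
  apply: eq_bigl => K; have [KB2|KB2] := boolP (K \in even_B_not2 R n).
    by move: (KB2); rewrite inE => /andP[-> ->]; rewrite (even_part_sub (R := R)) // andbT.
  by move: KB2; rewrite inE negb_and negbK => /orP[/negbTE->|->] //; rewrite andbF.
rewrite sum_correction // big1 ?addr0 // => S /eqP S2; have [HS|] := eqVneq H (zS S) => //.
move: HB2; rewrite inE HS zeros_gstab => /andP[_ /eqP[]].
rewrite -[RHS]S2; congr #|pred_of_set _|; apply/setP=> i.
by rewrite inE lres_zero andbT.
Qed.

End Main.

Theorem mainTheorem6 (R : realType) (n : nat) (hn : (2 <= n)%N) :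
  even_char_poly (reprD n R) =
    even_char_poly (reprB n R)
    + 'C(n, 2)%:R * 'X * even_char_poly (reprB (n - 2) R) :> {poly int}.
Proof.
have /choice[g gP] (S : {set 'I_n}) : exists gS : {group signed_perm n} -> int, #|S| = 2%N ->
  [/\ {in even_B R n, forall H : {group signed_perm n}, \sum_(K in even_B R n | K \subset H) gS K =
        (H == gstab (WB n) (lres (fun=> 0) S))%:R},
      forall H : {group signed_perm n}, ~~ (gstab (WB n) (lres (fun=> 0) S) \subset H) -> gS H = 0 &
      \sum_(H in even_B R n) gS H *: 'X^((reflection_rank (reprB n R) H)./2) =
        'X * even_char_poly (reprB (n - 2) R)].
  have [S2|/eqP nS2] := eqVneq #|S| 2%N; last by exists (fun=> 0).
  by have [gS gSP] := shifted_exists R S2; exists gS.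
have g_sum (S : {set 'I_n}) (S2 : #|S| = 2%N) := let: And3 h _ _ := gP S S2 in h.
have g0 (S : {set 'I_n}) (H : {group signed_perm n}) (S2 : #|S| = 2%N) := let: And3 _ h _ := gP S S2 in h H.
have g_poly (S : {set 'I_n}) (S2 : #|S| = 2%N) := let: And3 _ _ h := gP S S2 in h.
pose rk (H : {group signed_perm n}) := ((reflection_rank (reprB n R) H)./2).
rewrite {1}/even_char_poly even_D_image (big_imset _ (@even_part_inj R n)) /=.
(* The removed elements can be put back, since [correction] vanishes on them. *)
transitivity (\sum_(H in even_B R n) correction R g H *: 'X^(rk H)).
  rewrite [RHS](bigID (fun H => #|zeros H| == 2%N)) /= [X in X + _]big1 ?add0r; last first.
    by move=> H /andP[HB /eqP HZ]; rewrite (correction_eq0 g_sum) // scale0r.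
  apply: eq_big => [H|H HB2]; first by rewrite inE.
  by rewrite (moebius_evenD g_sum) // reflection_rank_even_part.
rewrite (eq_bigr (fun H => moebius_even (reprB n R) 1%G H *: 'X^(rk H) +
    \sum_(S : {set 'I_n} | #|S| == 2%N) g S H *: 'X^(rk H))); last first.
  by move=> H _; rewrite scalerDl scaler_suml.
rewrite big_split /=; congr (_ + _); rewrite exchange_big /=.
rewrite (eq_bigr (fun=> 'X * even_char_poly (reprB (n - 2) R))); last first.
  by move=> S /eqP S2; apply: g_poly.
rewrite sumr_const (_ : #|_| = 'C(n, 2)); first by rewrite -[LHS]mulr_natl mulrA.
by rewrite -[in RHS](card_ord n) -card_draws; apply: eq_card => S; rewrite inE.
Qed.
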